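(* Let $J=\mathbb{N}$ and $J^*=\mathbb{N}\setminus\{1\}$, or $J=J^*=\mathbb{Z}$. Let $(X_k)_{k\in J}$ be Banach spaces, let $T_k\in L(X_k,X_{k-1})$ for $k\in J^*$ with $\sup_{k\in J^*}\|T_k\|<\infty$, and let $1\le p<\infty$. The operator $B_{(T_k)}$ is chaotic on $\ell^p((X_k)_k,J)$ (resp. on $c_0((X_k)_k,J)$) if and only if for every $k\in J$ there exists a set $\mathcal{D}_k$ in $X_k$ such that $\operatorname{span}(\mathcal{D}_k)$ is dense in $X_k$ and such that for every $x_k\in\mathcal{D}_k$ there exists a sequence $(x_n)_{n\ge k+1}$ with $x_n\in X_n$ and $T_nx_n=x_{n-1}$ for every $n\ge k+1$, and such that - if $J=\mathbb{N}$, $(0,\dots,0,x_k,x_{k+1},\dots)\in\ell^p((X_k)_k,\mathbb{N})$ (resp. $c_0((X_k)_k,\mathbb{N})$); - if $J=\mathbb{Z}$, $(\dots,T_{k-2,k}x_k,T_{k-1,k}x_k,x_k,x_{k+1},\dots)\in\ell^p((X_k)_k,\mathbb{Z})$ (resp. $c_0((X_k)_k,\mathbb{Z})$), where in both sequences each $x_n$ is placed in position $n$ and each $T_{m,k}x_k$ in position $m$. Moreover, if $B_{(T_k)}$ is chaotic on $\ell^p((X_k)_k,J)$ (resp. $c_0((X_k)_k,J)$), then $B_{(T_k)}$ is mixing on $\ell^p((X_k)_k,J)$ (resp. $c_0((X_k)_k,J)$).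
   Context: $\mathbb{N}=\{1,2,3,\dots\}$; Banach spaces are over $\mathbb{K}=\mathbb{R}$ or $\mathbb{C}$, and $L(X,Z)$ denotes the bounded linear operators from $X$ to $Z$. $\ell^p((X_k)_k,J)=\{(x_k)_{k}\in\prod_{k\in J} X_k:\sum_k\|x_k\|^p<\infty\}$ with norm $(\sum_k\|x_k\|^p)^{1/p}$, and $c_0((X_k)_k,J)=\{(x_k)_k\in\prod_{k\in J} X_k:\lim_{|k|\to\infty}\|x_k\|=0\}$ with norm $\sup_k\|x_k\|$. The shift is $B_{(T_k)}(x_k)_{k\in J}=(T_{k+1}x_{k+1})_{k\in J}$; it is a bounded operator on these spaces exactly when $\sup_k\|T_k\|<\infty$. For $k<n$, $T_{k,n}=T_{k+1}\circ\cdots\circ T_n\in L(X_n,X_k)$. An operator $S$ on a Banach space $Y$ is hypercyclic if some $y\in Y$ has dense orbit $\{S^ny:n\ge 0\}$; chaotic if it is hypercyclic and its set of periodic points (those $y$ with $S^dy=y$ for some $d\ge1$) is dense in $Y$; mixing if for all non-empty open sets $U,V\subset Y$ the set $\{n\ge 0:S^nU\cap V\neq\emptyset\}$ is cofinite.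
   Formalization: The implication from the existence of the sets D_k to chaos is proved only when every X_k is separable; for non-separable X_k it is false (X_k=Z non-separable, T_k=2·Id, J=ℕ). The converse and chaotic ⇒ mixing hold for arbitrary Banach spaces. *)

(* Defs.v *)
From Stdlib Require Import Reals ZArith List FinFun Lra Lia.
From Stdlib Require Import FunctionalExtensionality ProofIrrelevance.
From Coquelicot Require Import Coquelicot.

Open Scope R_scope.

Section Dynamics.

Context {Y : UniformSpace}.

Definition dense (A : Y -> Prop) : Prop :=
  forall V : Y -> Prop, open V -> (exists y, V y) -> exists y, V y /\ A y.

Definition separable : Prop :=
  exists u : nat -> Y, dense (fun y => exists n, y = u n).

Definition hypercyclic (S : Y -> Y) : Prop :=
  exists y, dense (fun z => exists n, z = Nat.iter n S y).

Definition periodic (S : Y -> Y) (y : Y) : Prop :=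
  exists d, (1 <= d)%nat /\ Nat.iter d S y = y.

Definition chaotic (S : Y -> Y) : Prop :=
  hypercyclic S /\ dense (periodic S).

(** [eventually] is the filter of cofinite subsets of [nat]. *)
Definition mixing (S : Y -> Y) : Prop :=
  forall U V : Y -> Prop,
    open U -> open V -> (exists y, U y) -> (exists y, V y) ->
    eventually (fun n => exists y, U y /\ V (Nat.iter n S y)).

End Dynamics.

Arguments separable Y : clear implicits.

Inductive span {K : Ring} {V : ModuleSpace K} (D : V -> Prop) : V -> Prop :=
  | span_zero : span D zero
  | span_in x : D x -> span D x
  | span_plus x y : span D x -> span D y -> span D (plus x y)
  | span_scal (a : K) x : span D x -> span D (scal a x).

(** The operator norm, [p_infty] for an unbounded map. *)
Definition op_norm {K : AbsRing} {U V : NormedModule K} (f : U -> V) : Rbar :=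
  Glb_Rbar (fun M => 0 <= M /\ forall x, norm (f x) <= M * norm x).

Variant index := Naturals | Integers.

(** The positive integers are represented by [nat], with [k : nat] standing
    for the index [k + 1]. *)
Definition idx (J : index) : Set :=
  match J with Naturals => nat | Integers => Z end.

Coercion idx : index >-> Sortclass.

Definition isucc {J : index} : J -> J :=
  match J with Naturals => S | Integers => Z.succ end.

Definition ile {J : index} : J -> J -> Prop :=
  match J with Naturals => le | Integers => Z.le end.

Definition ilt {J : index} : J -> J -> Prop :=
  match J with Naturals => lt | Integers => Z.lt end.

Definition iabs {J : index} : J -> nat :=
  match J with Naturals => fun k => S k | Integers => Z.abs_nat end.

(** [Rpower 0 p] is [1] in the standard library. *)
Definition rpow (t p : R) : R := if Rlt_dec 0 t then Rpower t p else 0.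

Definition lsum {I : Type} (f : I -> R) (l : list I) : R :=
  fold_right (fun k s => f k + s) 0 l.

(** Sum of a family of nonnegative reals: the supremum of its finite partial
    sums. *)
Definition fam_sum {I : Type} (f : I -> R) : Rbar :=
  Lub_Rbar (fun s => exists l, NoDup l /\ s = lsum f l).

Section Sequences.

Context {K : AbsRing} {J : index}.

Definition pseq (X : J -> CompleteNormedModule K) : Type := forall k, X k.

Context (X : J -> CompleteNormedModule K).

Implicit Types x y : pseq X.

Definition pzero : pseq X := fun k => zero.
Definition pplus x y : pseq X := fun k => plus (x k) (y k).
Definition popp x : pseq X := fun k => opp (x k).
Definition pscal (a : K) x : pseq X := fun k => scal a (x k).

(** [T k] is the operator usually written [T_(k+1)], from [X_(k+1)] to
    [X_k]; indexing by the target avoids transport along [k + 1 - 1 = k]. *)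
Definition pshift (T : forall k, X (isucc k) -> X k) x : pseq X :=
  fun k => T k (x (isucc k)).

Record seq_space := SeqSpace {
  mem : pseq X -> Prop;
  snorm : pseq X -> R;
  mem_zero : mem pzero;
  mem_plus : forall x y, mem x -> mem y -> mem (pplus x y);
  mem_scal : forall a x, mem x -> mem (pscal a x);
  snorm_triangle : forall x y, mem x -> mem y ->
    snorm (pplus x y) <= snorm x + snorm y;
  snorm_scal : forall a x, mem x -> snorm (pscal a x) <= abs a * snorm x;
  snorm_eq_zero : forall x, mem x -> snorm x = 0 -> x = pzero;
  mem_shift : forall T : (forall k, X (isucc k) -> X k),
    (exists M, forall k, Rbar_le (op_norm (T k)) (Finite M)) ->
    forall x, mem x -> mem (pshift T x)
}.

End Sequences.

Arguments pshift {K J X} T x.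
Arguments mem {K J X} s x.
Arguments snorm {K J X} s x.
Arguments mem_zero {K J X} s.
Arguments mem_plus {K J X} s x y.
Arguments mem_scal {K J X} s a x.
Arguments snorm_triangle {K J X} s x y.
Arguments snorm_scal {K J X} s a x.
Arguments snorm_eq_zero {K J X} s x.
Arguments mem_shift {K J X} s T _ x.

Section SeqSpaceNormedModule.

Context {K : AbsRing} {J : index} {X : J -> CompleteNormedModule K}.
Context (E : seq_space X).

Definition elt : Type := {x : pseq X | mem E x}.

Lemma elt_eq (x y : elt) : (forall k, proj1_sig x k = proj1_sig y k) -> x = y.
Proof.
destruct x as [x hx], y as [y hy]; simpl; intros h.
assert (e : x = y) by now apply functional_extensionality_dep.
subst y; f_equal; apply proof_irrelevance.
Qed.

Lemma popp_pscal (x : pseq X) : popp X x = pscal X (opp one) x.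
Proof.
apply functional_extensionality_dep; intros k.
now unfold popp, pscal; rewrite scal_opp_one.
Qed.

Lemma mem_opp (x : pseq X) : mem E x -> mem E (popp X x).
Proof. rewrite popp_pscal; apply mem_scal. Qed.

Definition ezero : elt := exist _ _ (mem_zero E).
Definition eplus (x y : elt) : elt :=
  exist _ _ (mem_plus E _ _ (proj2_sig x) (proj2_sig y)).
Definition eopp (x : elt) : elt := exist _ _ (mem_opp _ (proj2_sig x)).
Definition escal (a : K) (x : elt) : elt :=
  exist _ _ (mem_scal E a _ (proj2_sig x)).

Lemma eplusC x y : eplus x y = eplus y x.
Proof. apply elt_eq; intros k; apply plus_comm. Qed.

Lemma eplusA x y z : eplus x (eplus y z) = eplus (eplus x y) z.
Proof. apply elt_eq; intros k; apply plus_assoc. Qed.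

Lemma eplus0 x : eplus x ezero = x.
Proof. apply elt_eq; intros k; apply plus_zero_r. Qed.

Lemma eplusN x : eplus x (eopp x) = ezero.
Proof. apply elt_eq; intros k; apply (plus_opp_r (proj1_sig x k)). Qed.

Lemma escalA a b x : escal a (escal b x) = escal (mult a b) x.
Proof. apply elt_eq; intros k; apply (scal_assoc a b (proj1_sig x k)). Qed.

Lemma escal1 x : escal one x = x.
Proof. apply elt_eq; intros k; apply (scal_one (proj1_sig x k)). Qed.

Lemma escalDr a x y : escal a (eplus x y) = eplus (escal a x) (escal a y).
Proof.
apply elt_eq; intros k.
apply (scal_distr_l a (proj1_sig x k) (proj1_sig y k)).
Qed.

Lemma escalDl a b x : escal (plus a b) x = eplus (escal a x) (escal b x).
Proof. apply elt_eq; intros k; apply (scal_distr_r a b (proj1_sig x k)). Qed.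

Definition elt_AbelianMonoid :=
  AbelianMonoid.Pack elt (AbelianMonoid.Mixin _ _ _ eplusC eplusA eplus0) elt.

Definition elt_AbelianGroup :=
  AbelianGroup.Pack elt
    (AbelianGroup.Class _ (AbelianMonoid.Mixin _ _ _ eplusC eplusA eplus0)
       (AbelianGroup.Mixin elt_AbelianMonoid _ eplusN)) elt.

Definition elt_ModuleSpace :=
  ModuleSpace.Pack K elt
    (ModuleSpace.Class K elt _
       (ModuleSpace.Mixin K elt_AbelianGroup _ escalA escal1 escalDr escalDl))
    elt.

Definition eball (x : elt) (eps : R) (y : elt) : Prop :=
  snorm E (proj1_sig (eplus y (eopp x))) < eps.

Lemma snorm_zero : snorm E (pzero X) <= 0.
Proof.
replace (pzero X) with (pscal X zero (pzero X)).
- generalize (snorm_scal E zero _ (mem_zero E)).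
  now rewrite abs_zero, Rmult_0_l.
- apply functional_extensionality_dep; intros k; apply (scal_zero_r (V := X k)).
Qed.

Lemma eball_center x (e : posreal) : eball x e x.
Proof.
unfold eball; rewrite eplusN.
eapply Rle_lt_trans; [apply snorm_zero | apply cond_pos].
Qed.

Lemma eball_sym x y e : eball x e y -> eball y e x.
Proof.
unfold eball; intros h; eapply Rle_lt_trans; [| exact h].
replace (eplus x (eopp y)) with (escal (opp one) (eplus y (eopp x))).
- eapply Rle_trans; [apply snorm_scal, proj2_sig |].
  rewrite abs_opp_one; lra.
- apply elt_eq; intros k; simpl; unfold pscal, pplus, popp.
  rewrite scal_opp_one.
  exact (opp_minus (proj1_sig y k) (proj1_sig x k)).
Qed.

Lemma eball_triangle x y z e1 e2 :
  eball x e1 y -> eball y e2 z -> eball x (e1 + e2) z.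
Proof.
unfold eball; intros h1 h2.
replace (eplus z (eopp x)) with
  (eplus (eplus y (eopp x)) (eplus z (eopp y))).
- eapply Rle_lt_trans; [apply snorm_triangle; apply proj2_sig |].
  now apply Rplus_lt_compat.
- apply elt_eq; intros k; simpl; unfold pplus, popp.
  rewrite plus_comm.
  symmetry.
  exact (minus_trans (proj1_sig y k) (proj1_sig z k) (proj1_sig x k)).
Qed.

Definition elt_UniformSpace :=
  UniformSpace.Pack elt
    (UniformSpace.Mixin elt ezero eball eball_center eball_sym eball_triangle)
    elt.

Definition elt_NormedModuleAux :=
  NormedModuleAux.Pack K elt
    (NormedModuleAux.Class K elt (ModuleSpace.class K elt_ModuleSpace)
       (UniformSpace.class elt_UniformSpace)) elt.

Definition enorm (x : elt) : R := snorm E (proj1_sig x).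

Lemma enorm_ball (x y : elt_NormedModuleAux) (e : R) :
  enorm (minus y x) < e -> ball x e y.
Proof. exact (fun h => h). Qed.

Lemma ball_enorm (x y : elt_NormedModuleAux) (e : posreal) :
  ball x e y -> enorm (minus y x) < 1 * e.
Proof. now rewrite Rmult_1_l. Qed.

Lemma enorm_triangle (x y : elt_NormedModuleAux) :
  enorm (plus x y) <= enorm x + enorm y.
Proof. apply (snorm_triangle E); apply proj2_sig. Qed.

Lemma enorm_scal (a : K) (x : elt_NormedModuleAux) :
  enorm (scal a x) <= abs a * enorm x.
Proof. apply (snorm_scal E), proj2_sig. Qed.

Lemma enorm_eq_zero (x : elt_NormedModuleAux) : enorm x = 0 -> x = zero.
Proof.
intros h; apply elt_eq; intros k.
now rewrite (snorm_eq_zero E _ (proj2_sig x) h).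
Qed.

Definition seq_module : NormedModule K :=
  NormedModule.Pack K elt
    (NormedModule.Class K elt (NormedModuleAux.class K elt_NormedModuleAux)
       (NormedModule.Mixin K elt_NormedModuleAux enorm 1 enorm_triangle
          enorm_scal enorm_ball ball_enorm enorm_eq_zero)) elt.

End SeqSpaceNormedModule.

Coercion seq_module : seq_space >-> NormedModule.type.

Definition shift {K : AbsRing} {J : index} {X : J -> CompleteNormedModule K}
    (E : seq_space X) (T : forall k, X (isucc k) -> X k)
    (hT : exists M, forall k, Rbar_le (op_norm (T k)) (Finite M)) (x : E) : E :=
  exist _ (pshift T (proj1_sig x)) (mem_shift E T hT _ (proj2_sig x)).

Lemma op_norm_bound {K : AbsRing} {U V : NormedModule K} (f : U -> V) (M : R) :
  Rbar_le (op_norm f) (Finite M) -> forall x, norm (f x) <= M * norm x.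
Proof.
intros hM x.
destruct (Glb_Rbar_correct
  (fun M => 0 <= M /\ forall x, norm (f x) <= M * norm x)) as [_ hg].
fold (op_norm f) in hg.
apply Rnot_lt_le; intros hlt.
assert (hx := norm_ge_0 x).
destruct hx as [hx | hx].
- assert (h : Rbar_le (Finite (norm (f x) / norm x)) (op_norm f)).
  { apply hg; intros m [_ hm]; simpl.
    apply Rmult_le_reg_r with (norm x); [assumption |].
    field_simplify; [rewrite Rmult_comm |]; try lra.
    generalize (hm x); lra. }
  assert (h' := Rbar_le_trans _ _ _ h hM); simpl in h'.
  apply Rmult_le_compat_r with (r := norm x) in h'; [| lra].
  unfold Rdiv in h'; rewrite Rmult_assoc, Rinv_l in h'; lra.
- assert (h : Rbar_le p_infty (op_norm f)).
  { apply hg; intros m [_ hm]; generalize (hm x).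
    rewrite <- hx in *; rewrite Rmult_0_r in *; lra. }
  now assert (h' := Rbar_le_trans _ _ _ h hM).
Qed.

Lemma norm_pzero {K : AbsRing} {J : index} (X : J -> CompleteNormedModule K) k :
  norm (pzero X k) = 0.
Proof. exact (norm_zero (V := X k)). Qed.

Lemma isucc_inj {J : index} (k l : J) : isucc k = isucc l -> k = l.
Proof. destruct J; simpl; lia. Qed.

Lemma iabs_isucc {J : index} (k : J) : (iabs k <= S (iabs (isucc k)))%nat.
Proof. destruct J; simpl; lia. Qed.

Lemma iabs_bounded {J : index} (f : J -> R) (N : nat) :
  exists M, forall k, (iabs k < N)%nat -> f k <= M.
Proof.
induction N as [| N [M hM]]; [exists 0; intros k hk; lia |].
destruct J; simpl in *.
- exists (Rmax M (f (Nat.pred N))); intros k hk.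
  destruct (Nat.eq_dec (S k) N) as [<- | h]; [apply Rmax_r |].
  eapply Rle_trans; [apply hM; lia | apply Rmax_l].
- exists (Rmax M (Rmax (f (Z.of_nat N)) (f (- Z.of_nat N)%Z))); intros k hk.
  destruct (Z.eq_dec k (Z.of_nat N)) as [-> | h1].
  { eapply Rle_trans; [apply Rmax_l | apply Rmax_r]. }
  destruct (Z.eq_dec k (- Z.of_nat N)) as [-> | h2].
  { eapply Rle_trans; [apply Rmax_r | apply Rmax_r]. }
  eapply Rle_trans; [apply hM; lia | apply Rmax_l].
Qed.

Lemma rpow_ge0 t p : 0 <= rpow t p.
Proof.
unfold rpow; destruct (Rlt_dec 0 t); [apply Rlt_le, exp_pos | lra].
Qed.

Lemma rpow_0 p : rpow 0 p = 0.
Proof. unfold rpow; destruct (Rlt_dec 0 0); lra. Qed.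

Lemma rpow_pos t p : 0 < t -> rpow t p = Rpower t p.
Proof. unfold rpow; destruct (Rlt_dec 0 t); lra. Qed.

Lemma rpow_mult a b p : 0 <= a -> 0 <= b ->
  rpow (a * b) p = rpow a p * rpow b p.
Proof.
intros [ha | <-] [hb | <-]; rewrite ?Rmult_0_l, ?Rmult_0_r, ?rpow_0;
  rewrite ?Rmult_0_l, ?Rmult_0_r; try reflexivity.
rewrite !rpow_pos by (try apply Rmult_lt_0_compat; assumption).
symmetry; now apply Rpower_mult_distr.
Qed.

Lemma rpow_le a b p : 0 <= p -> 0 <= a <= b -> rpow a p <= rpow b p.
Proof.
intros hp [[ha | <-] hb]; [| rewrite rpow_0; apply rpow_ge0].
rewrite !rpow_pos by lra; apply Rle_Rpower_l; lra.
Qed.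

Lemma rpow_inv a p q : 0 <= a -> p * q = 1 -> rpow (rpow a p) q = a.
Proof.
intros [ha | <-] h; [| now rewrite !rpow_0].
rewrite (rpow_pos a) by assumption.
rewrite rpow_pos by apply exp_pos.
now rewrite Rpower_mult, h, Rpower_1.
Qed.

Lemma rpow_eq0 a p : 0 <= a -> rpow a p <= 0 -> a = 0.
Proof.
intros [ha | <-] h; [| reflexivity].
rewrite rpow_pos in h by assumption; generalize (exp_pos (p * ln a)).
unfold Rpower in h; lra.
Qed.

Lemma rpow_bernoulli s p : 1 <= p -> 0 <= s -> 1 + p * (s - 1) <= rpow s p.
Proof.
intros hp [hs | <-]; [| rewrite rpow_0; lra].
rewrite rpow_pos by assumption.
replace p with (1 + (p - 1)) at 2 by ring.
rewrite Rpower_plus, Rpower_1 by assumption.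
assert (h1 : 1 + (p - 1) * ln s <= Rpower s (p - 1)) by apply exp_ineq1_le.
assert (h2 : 1 - / s <= ln s).
{ generalize (exp_ineq1_le (- ln s)).
  rewrite exp_Ropp, exp_ln by assumption; lra. }
apply Rle_trans with (s * (1 + (p - 1) * (1 - / s))).
- right; field; lra.
- apply Rmult_le_compat_l; [lra |].
  eapply Rle_trans; [| exact h1].
  apply Rplus_le_compat_l, Rmult_le_compat_l; lra.
Qed.

Lemma rpow_convex a b t p : 1 <= p -> 0 <= a -> 0 <= b -> 0 <= t <= 1 ->
  rpow (t * a + (1 - t) * b) p <= t * rpow a p + (1 - t) * rpow b p.
Proof.
intros hp ha hb ht.
set (c := t * a + (1 - t) * b).
assert (hc : 0 <= c) by (unfold c; nra).
destruct hc as [hc | hc].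
2: { rewrite <- hc, rpow_0.
     generalize (rpow_ge0 a p) (rpow_ge0 b p); intros; nra. }
assert (tangent : forall u, 0 <= u ->
  rpow c p * (1 + p * (u / c - 1)) <= rpow u p).
{ intros u hu.
  assert (hs : 0 <= u / c).
  { apply Rmult_le_pos; [assumption | apply Rlt_le, Rinv_0_lt_compat, hc]. }
  replace u with (c * (u / c)) at 2 by (field; lra).
  rewrite rpow_mult by lra.
  apply Rmult_le_compat_l; [apply rpow_ge0 | now apply rpow_bernoulli]. }
apply Rle_trans with
  (t * (rpow c p * (1 + p * (a / c - 1)))
   + (1 - t) * (rpow c p * (1 + p * (b / c - 1)))).
- right; replace (t * (rpow c p * (1 + p * (a / c - 1)))
   + (1 - t) * (rpow c p * (1 + p * (b / c - 1)))) with
   (rpow c p * (1 + p * ((t * a + (1 - t) * b) / c - 1))) by (field; lra).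
  fold c; field; lra.
- apply Rplus_le_compat; apply Rmult_le_compat_l; try lra; now apply tangent.
Qed.

Lemma lsum_le {I : Type} (f g : I -> R) l :
  (forall k, f k <= g k) -> lsum f l <= lsum g l.
Proof.
intros h; induction l as [| k l IH]; simpl; [lra |].
generalize (h k); lra.
Qed.

Lemma lsum_lin {I : Type} (f g : I -> R) a b l :
  lsum (fun k => a * f k + b * g k) l = a * lsum f l + b * lsum g l.
Proof. induction l as [| k l IH]; simpl; [ring | rewrite IH; ring]. Qed.

Lemma lsum_mult {I : Type} (f : I -> R) a l :
  lsum (fun k => a * f k) l = a * lsum f l.
Proof. induction l as [| k l IH]; simpl; [ring | rewrite IH; ring]. Qed.

Lemma lsum_map {I I' : Type} (f : I' -> R) (g : I -> I') l :
  lsum f (map g l) = lsum (fun k => f (g k)) l.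
Proof. induction l as [| k l IH]; simpl; [reflexivity | now rewrite IH]. Qed.

Lemma lsum_le_fam_sum {I : Type} (f : I -> R) l : NoDup l ->
  Rbar_le (lsum f l) (fam_sum f).
Proof.
intros hl; destruct (Lub_Rbar_correct
  (fun s => exists l, NoDup l /\ s = lsum f l)) as [h _].
apply h; now exists l.
Qed.

Lemma fam_sum_le {I : Type} (f : I -> R) (M : R) :
  (forall l, NoDup l -> lsum f l <= M) -> Rbar_le (fam_sum f) M.
Proof.
intros h; destruct (Lub_Rbar_correct
  (fun s => exists l, NoDup l /\ s = lsum f l)) as [_ h'].
apply h'; intros s (l & hl & ->); now apply h.
Qed.

Lemma fam_sum_finite {I : Type} (f : I -> R) :
  Rbar_lt (fam_sum f) p_infty -> fam_sum f = Finite (real (fam_sum f)).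
Proof.
generalize (lsum_le_fam_sum f nil (NoDup_nil _)).
now destruct (fam_sum f).
Qed.

Section Lp.

Context {K : AbsRing} {J : index} (X : J -> CompleteNormedModule K).
Context (p : R) (hp : 1 <= p).

Definition in_lp (x : pseq X) : Prop :=
  Rbar_lt (fam_sum (fun k => rpow (norm (x k)) p)) p_infty.

Definition lp_norm (x : pseq X) : R :=
  rpow (real (fam_sum (fun k => rpow (norm (x k)) p))) (/ p).

Lemma lp_bound (x : pseq X) c : 0 <= c ->
  (forall l, NoDup l -> lsum (fun k => rpow (norm (x k)) p) l <= rpow c p) ->
  in_lp x /\ lp_norm x <= c.
Proof.
intros hc h.
assert (h1 := fam_sum_le _ _ h).
assert (h2 := lsum_le_fam_sum (fun k => rpow (norm (x k)) p) nil
                (NoDup_nil _)).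
unfold in_lp, lp_norm; destruct (fam_sum _) as [s | |]; simpl in *; try easy.
split; [exact I |].
rewrite <- (rpow_inv c p (/ p)) by (try assumption; field; lra).
apply rpow_le; [| lra].
apply Rlt_le, Rinv_0_lt_compat; lra.
Qed.

Lemma lp_norm_sum (x : pseq X) : in_lp x -> forall l, NoDup l ->
  lsum (fun k => rpow (norm (x k)) p) l <= rpow (lp_norm x) p.
Proof.
intros hx l hl.
assert (h1 := lsum_le_fam_sum (fun k => rpow (norm (x k)) p) l hl).
assert (h2 := lsum_le_fam_sum (fun k => rpow (norm (x k)) p) nil
                (NoDup_nil _)).
unfold lp_norm; rewrite fam_sum_finite in h1, h2 by exact hx; simpl in h1, h2.
rewrite rpow_inv; [assumption | assumption | field; lra].
Qed.

Lemma lp_norm_ge0 (x : pseq X) : 0 <= lp_norm x.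
Proof. apply rpow_ge0. Qed.

Lemma lp_zero : in_lp (pzero X).
Proof.
apply (lp_bound _ 0); [lra |]; intros l _; rewrite rpow_0.
replace 0 with (0 * lsum (fun _ => 0) l) by ring.
rewrite <- lsum_mult; apply lsum_le; intros k.
rewrite norm_pzero, rpow_0; lra.
Qed.

Lemma lp_plus_bound (x y : pseq X) e : 0 < e -> in_lp x -> in_lp y ->
  in_lp (pplus X x y) /\ lp_norm (pplus X x y) <= lp_norm x + lp_norm y + e.
Proof.
intros he hx hy.
set (a := lp_norm x + e / 2); set (b := lp_norm y + e / 2).
assert (ha : 0 < a) by (unfold a; generalize (lp_norm_ge0 x); lra).
assert (hb : 0 < b) by (unfold b; generalize (lp_norm_ge0 y); lra).
replace (lp_norm x + lp_norm y + e) with (a + b) by (unfold a, b; lra).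
assert (sx : forall l, NoDup l ->
  lsum (fun k => rpow (norm (x k)) p) l <= rpow a p).
{ intros l hl; eapply Rle_trans; [now apply lp_norm_sum |].
  apply rpow_le; unfold a; generalize (lp_norm_ge0 x); lra. }
assert (sy : forall l, NoDup l ->
  lsum (fun k => rpow (norm (y k)) p) l <= rpow b p).
{ intros l hl; eapply Rle_trans; [now apply lp_norm_sum |].
  apply rpow_le; unfold b; generalize (lp_norm_ge0 y); lra. }
apply lp_bound; [lra |]; intros l hl.
set (t := a / (a + b)).
assert (hia : 0 < / a) by now apply Rinv_0_lt_compat.
assert (hib : 0 < / b) by now apply Rinv_0_lt_compat.
assert (hiab : 0 < / (a + b)) by (apply Rinv_0_lt_compat; lra).
assert (ht : 0 <= t) by (unfold t; apply Rmult_le_pos; lra).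
assert (ht' : 1 - t = b * / (a + b)) by (unfold t; field; lra).
assert (ht1 : 0 <= 1 - t) by (rewrite ht'; apply Rmult_le_pos; lra).
apply Rle_trans with (lsum (fun k =>
  (rpow (a + b) p * t * rpow (/ a) p) * rpow (norm (x k)) p
  + (rpow (a + b) p * (1 - t) * rpow (/ b) p) * rpow (norm (y k)) p) l).
- apply lsum_le; intros k.
  assert (nx := norm_ge_0 (x k)); assert (ny := norm_ge_0 (y k)).
  assert (nax : 0 <= / a * norm (x k)) by (apply Rmult_le_pos; lra).
  assert (nby : 0 <= / b * norm (y k)) by (apply Rmult_le_pos; lra).
  apply Rle_trans with (rpow ((a + b) *
    (t * (/ a * norm (x k)) + (1 - t) * (/ b * norm (y k)))) p).
  + apply rpow_le; [lra | split; [apply norm_ge_0 |]].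
    eapply Rle_trans; [apply (norm_triangle (x k) (y k)) |].
    right; unfold t; field; lra.
  + rewrite rpow_mult; [| lra | nra].
    apply Rle_trans with (rpow (a + b) p *
      (t * rpow (/ a * norm (x k)) p + (1 - t) * rpow (/ b * norm (y k)) p)).
    * apply Rmult_le_compat_l; [apply rpow_ge0 |].
      apply rpow_convex; lra.
    * rewrite !rpow_mult by lra; right; ring.
- rewrite lsum_lin.
  assert (pa : rpow (/ a) p * rpow a p = 1).
  { rewrite <- rpow_mult, Rinv_l, rpow_pos by lra.
    unfold Rpower; rewrite ln_1, Rmult_0_r; apply exp_0. }
  assert (pb : rpow (/ b) p * rpow b p = 1).
  { rewrite <- rpow_mult, Rinv_l, rpow_pos by lra.
    unfold Rpower; rewrite ln_1, Rmult_0_r; apply exp_0. }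
  apply Rle_trans with (rpow (a + b) p * t * (rpow (/ a) p * rpow a p)
    + rpow (a + b) p * (1 - t) * (rpow (/ b) p * rpow b p)).
  + rewrite <- !Rmult_assoc.
    apply Rplus_le_compat; apply Rmult_le_compat_l; auto;
      repeat apply Rmult_le_pos; auto using rpow_ge0; lra.
  + rewrite pa, pb; right; ring.
Qed.

Lemma lp_plus (x y : pseq X) : in_lp x -> in_lp y -> in_lp (pplus X x y).
Proof. intros hx hy; now apply (lp_plus_bound x y 1); [lra | |]. Qed.

Lemma lp_triangle (x y : pseq X) : in_lp x -> in_lp y ->
  lp_norm (pplus X x y) <= lp_norm x + lp_norm y.
Proof.
intros hx hy; apply le_epsilon; intros e he.
now apply lp_plus_bound.
Qed.

Lemma lp_scal_bound (a : K) (x : pseq X) : in_lp x ->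
  in_lp (pscal X a x) /\ lp_norm (pscal X a x) <= abs a * lp_norm x.
Proof.
intros hx; assert (ha := abs_ge_0 a); assert (hn := lp_norm_ge0 x).
apply lp_bound; [now apply Rmult_le_pos |]; intros l hl.
rewrite rpow_mult by assumption.
eapply Rle_trans with (rpow (abs a) p * lsum (fun k => rpow (norm (x k)) p) l).
- rewrite <- lsum_mult; apply lsum_le; intros k.
  rewrite <- rpow_mult by (try apply norm_ge_0; assumption).
  apply rpow_le; [lra | split; [apply norm_ge_0 | apply (norm_scal a (x k))]].
- apply Rmult_le_compat_l; [apply rpow_ge0 | now apply lp_norm_sum].
Qed.

Lemma lp_eq_zero (x : pseq X) : in_lp x -> lp_norm x = 0 -> x = pzero X.
Proof.
intros hx h; apply functional_extensionality_dep; intros k.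
apply (norm_eq_zero (x k)), (rpow_eq0 _ p); [apply norm_ge_0 |].
assert (hk : NoDup (k :: nil)) by (constructor; [easy | constructor]).
generalize (lp_norm_sum x hx _ hk); simpl; rewrite h, rpow_0; lra.
Qed.

Lemma lp_shift (T : forall k, X (isucc k) -> X k) :
  (exists M, forall k, Rbar_le (op_norm (T k)) (Finite M)) ->
  forall x, in_lp x -> in_lp (pshift T x).
Proof.
intros [M hM] x hx; set (M' := Rmax M 0).
assert (hM0 : 0 <= M') by apply Rmax_r.
apply (lp_bound _ (M' * lp_norm x)).
{ apply Rmult_le_pos; [assumption | apply lp_norm_ge0]. }
intros l hl; rewrite rpow_mult by (try apply lp_norm_ge0; assumption).
apply Rle_trans with
  (rpow M' p * lsum (fun k => rpow (norm (x k)) p) (map isucc l)).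
- rewrite lsum_map, <- lsum_mult; apply lsum_le; intros k.
  rewrite <- rpow_mult by (try apply norm_ge_0; assumption).
  apply rpow_le; [lra | split; [apply norm_ge_0 |]].
  eapply Rle_trans; [apply (op_norm_bound _ _ (hM k)) |].
  apply Rmult_le_compat_r; [apply norm_ge_0 | apply Rmax_l].
- apply Rmult_le_compat_l; [apply rpow_ge0 |].
  apply lp_norm_sum; [assumption |].
  now apply Injective_map_NoDup; [intros k n; apply isucc_inj |].
Qed.

Definition lp : seq_space X :=
  SeqSpace X in_lp lp_norm lp_zero lp_plus
    (fun a x hx => proj1 (lp_scal_bound a x hx)) lp_triangle
    (fun a x hx => proj2 (lp_scal_bound a x hx)) lp_eq_zero lp_shift.

End Lp.

Section C0.

Context {K : AbsRing} {J : index} (X : J -> CompleteNormedModule K).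

Definition in_c0 (x : pseq X) : Prop :=
  forall eps : posreal, exists N, forall k, (N <= iabs k)%nat ->
    norm (x k) < eps.

Definition c0_norm (x : pseq X) : R :=
  real (Lub_Rbar (fun r => exists k, r = norm (x k))).

Lemma index_inhabited : exists k : J, True.
Proof. destruct J; [now exists O | now exists Z0]. Qed.

Lemma c0_norm_le (x : pseq X) M :
  (forall k, norm (x k) <= M) -> c0_norm x <= M.
Proof.
intros h; destruct index_inhabited as [k0 _]; unfold c0_norm.
destruct (Lub_Rbar_correct (fun r => exists k, r = norm (x k))) as [h1 h2].
assert (h3 : Rbar_le (Lub_Rbar (fun r => exists k, r = norm (x k))) M).
{ apply h2; intros r [k ->]; apply h. }
assert (h4 := h1 (norm (x k0)) (ex_intro _ k0 eq_refl)).
now destruct (Lub_Rbar _).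
Qed.

Lemma le_c0_norm (x : pseq X) k : in_c0 x -> norm (x k) <= c0_norm x.
Proof.
intros hx; unfold c0_norm.
destruct (Lub_Rbar_correct (fun r => exists k, r = norm (x k))) as [h1 h2].
destruct (hx (mkposreal 1 Rlt_0_1)) as [N hN]; simpl in hN.
destruct (iabs_bounded (fun k => norm (x k)) N) as [M hM].
assert (h3 : Rbar_le (Lub_Rbar (fun r => exists k, r = norm (x k)))
               (Rmax M 1)).
{ apply h2; intros r [n ->]; simpl.
  destruct (Nat.lt_ge_cases (iabs n) N) as [hn | hn].
  - eapply Rle_trans; [now apply hM | apply Rmax_l].
  - eapply Rle_trans; [now apply Rlt_le, hN | apply Rmax_r]. }
assert (h4 := h1 (norm (x k)) (ex_intro _ k eq_refl)).
now destruct (Lub_Rbar _).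
Qed.

Lemma c0_norm_ge0 (x : pseq X) : in_c0 x -> 0 <= c0_norm x.
Proof.
intros hx; destruct index_inhabited as [k _].
eapply Rle_trans; [apply (norm_ge_0 (x k)) | now apply (le_c0_norm x k)].
Qed.

Lemma c0_zero : in_c0 (pzero X).
Proof.
intros eps; exists O; intros k _.
rewrite norm_pzero; apply cond_pos.
Qed.

Lemma c0_plus (x y : pseq X) : in_c0 x -> in_c0 y -> in_c0 (pplus X x y).
Proof.
intros hx hy eps.
destruct (hx (pos_div_2 eps)) as [N hN]; destruct (hy (pos_div_2 eps)) as [N' hN'].
exists (Nat.max N N'); intros k hk.
eapply Rle_lt_trans; [apply (norm_triangle (x k) (y k)) |].
generalize (hN k ltac:(lia)) (hN' k ltac:(lia)); simpl; lra.
Qed.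

Lemma c0_dominated (x y : pseq X) C :
  (forall k, norm (y k) <= C * norm (x k)) -> in_c0 x -> in_c0 y.
Proof.
intros h hx eps.
assert (hC : 0 < Rabs C + 1) by (generalize (Rabs_pos C); lra).
assert (he : 0 < eps / (Rabs C + 1)).
{ apply Rdiv_lt_0_compat; [apply cond_pos | exact hC]. }
destruct (hx (mkposreal _ he)) as [N hN]; simpl in hN.
exists N; intros k hk; assert (hk' := hN k hk).
apply Rle_lt_trans with ((Rabs C + 1) * norm (x k)).
- eapply Rle_trans; [apply h |].
  apply Rmult_le_compat_r; [apply norm_ge_0 |].
  generalize (Rle_abs C); lra.
- apply Rmult_lt_compat_l with (r := Rabs C + 1) in hk'; [| exact hC].
  replace ((Rabs C + 1) * (eps / (Rabs C + 1))) with (pos eps) in hk'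
    by (field; lra).
  exact hk'.
Qed.

Lemma c0_scal (a : K) (x : pseq X) : in_c0 x -> in_c0 (pscal X a x).
Proof.
apply (c0_dominated _ _ (abs a)); intros k; apply (norm_scal a (x k)).
Qed.

Lemma c0_triangle (x y : pseq X) : in_c0 x -> in_c0 y ->
  c0_norm (pplus X x y) <= c0_norm x + c0_norm y.
Proof.
intros hx hy; apply c0_norm_le; intros k.
eapply Rle_trans; [apply (norm_triangle (x k) (y k)) |].
apply Rplus_le_compat; now apply le_c0_norm.
Qed.

Lemma c0_norm_scal (a : K) (x : pseq X) : in_c0 x ->
  c0_norm (pscal X a x) <= abs a * c0_norm x.
Proof.
intros hx; apply c0_norm_le; intros k.
eapply Rle_trans; [apply (norm_scal a (x k)) |].
apply Rmult_le_compat_l; [apply abs_ge_0 | now apply le_c0_norm].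
Qed.

Lemma c0_eq_zero (x : pseq X) : in_c0 x -> c0_norm x = 0 -> x = pzero X.
Proof.
intros hx h; apply functional_extensionality_dep; intros k.
apply (norm_eq_zero (x k)), Rle_antisym; [| apply norm_ge_0].
rewrite <- h; now apply le_c0_norm.
Qed.

Lemma c0_shift (T : forall k, X (isucc k) -> X k) :
  (exists M, forall k, Rbar_le (op_norm (T k)) (Finite M)) ->
  forall x, in_c0 x -> in_c0 (pshift T x).
Proof.
intros [M hM] x hx eps.
assert (hC : 0 < Rabs M + 1) by (generalize (Rabs_pos M); lra).
assert (he : 0 < eps / (Rabs M + 1)).
{ apply Rdiv_lt_0_compat; [apply cond_pos | exact hC]. }
destruct (hx (mkposreal _ he)) as [N hN]; simpl in hN.
exists (S N); intros k hk.
assert (hk' := hN (isucc k) ltac:(generalize (iabs_isucc k); lia)).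
apply Rle_lt_trans with ((Rabs M + 1) * norm (x (isucc k))).
- eapply Rle_trans; [apply (op_norm_bound _ _ (hM k)) |].
  apply Rmult_le_compat_r; [apply norm_ge_0 |].
  generalize (Rle_abs M); lra.
- apply Rmult_lt_compat_l with (r := Rabs M + 1) in hk'; [| exact hC].
  replace ((Rabs M + 1) * (eps / (Rabs M + 1))) with (pos eps) in hk'
    by (field; lra).
  exact hk'.
Qed.

Definition c0 : seq_space X :=
  SeqSpace X in_c0 c0_norm c0_zero c0_plus c0_scal c0_triangle c0_norm_scal
    c0_eq_zero c0_shift.

End C0.

Section Orbits.

Context {K : AbsRing} {J : index} {X : J -> CompleteNormedModule K}.
Context (T : forall k, X (isucc k) -> X k).

(** [Tcomp j m] is the composition [T_(m+1) o ... o T_(m+j)] from [X_(m+j)]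
    to [X_m]. *)
Fixpoint Tcomp (j : nat) (m : J) : X (Nat.iter j isucc m) -> X m :=
  match j with
  | O => fun x => x
  | S i => fun x => Tcomp i m (T (Nat.iter i isucc m) x)
  end.

(** [z] is the sequence [(0, ..., 0, x_k, x_(k+1), ...)] if the index set is
    the set of positive integers, and the sequence
    [(..., T_(k-1,k) x_k, x_k, x_(k+1), ...)] if it is the set of integers,
    where [x_k = x]. In the last clause [m + j = k], so that the argument of
    [Tcomp j m] is [x_k]; quantifying over [m] and [j] avoids a transport from
    [X k] to [X (m + j)]. *)
Definition orbit_through (k : J) (x : X k) (z : pseq X) : Prop :=
  z k = x /\
  (forall n, ile k n -> T n (z (isucc n)) = z n) /\
  (J = Naturals -> forall n, ilt n k -> z n = zero) /\
  (J = Integers -> forall (m : J) (j : nat), Nat.iter j isucc m = k ->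
     z m = Tcomp j m (z (Nat.iter j isucc m))).

Definition dense_span_of_orbits (E : seq_space X) : Prop :=
  forall k, exists D : X k -> Prop,
    dense (span D) /\
    forall x, D x -> exists z, orbit_through k x z /\ mem E z.

End Orbits.

(* Main.v *)
From Stdlib Require Import ZArith List Lra Lia.
From Stdlib Require Import FunctionalExtensionality ProofIrrelevance.
From Stdlib Require Import IndefiniteDescription ClassicalEpsilon Cantor.
Require Import Defs.
From Stdlib Require Import Reals.
From Coquelicot Require Import Coquelicot.
Open Scope R_scope.

(* Write [S] for the shift. An orbit through [x_k] is, up to finitely many
   coordinates, a fixed point [z] of [S] with [z_k = x_k]. If [y] is periodic of
   period [d], restrict it to the residue class of [k] modulo [d] and sum the
   result over its orbit: this is a fixed point with [k]-th coordinate [y_k], so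
   density of the periodic points gives the sets [D_k].

   Conversely, let [z] be a fixed point and [v] its restriction to the coordinate
   [k]. Then [S^n v] is the restriction of [z] to position [k - n], [v] is the
   image under [S^n] of the restriction of [z] to position [k + n], and the
   restriction of [z] to the class of [k] modulo [n] is fixed by [S^n]. By the
   decay of [z] these are respectively close to [0], [0] and [v] for large [n].
   Such vectors [v] span a dense subspace, which gives mixing and density of the
   periodic points; a dense orbit then comes from a Baire argument, and only this
   uses separability. *)

(** * Birkhoff transitivity in complete separable uniform spaces *)

Section Baire.

Context {Y : UniformSpace}.

(** The spaces [E] are built as normed modules without a completeness structure, and the nested-ball
    argument only needs limits of Cauchy sequences. *)
Definition seq_complete : Prop :=
  forall x : nat -> Y,
    (forall eps : posreal, exists N, forall n m, (N <= n)%nat -> (N <= m)%nat ->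
       ball (x n) eps (x m)) ->
    exists l, forall eps : posreal, eventually (fun n => ball (x n) eps l).

(** Balls of a [UniformSpace] need not be open; this interior replaces them wherever an open set is
    required. *)
Lemma open_locally (A : Y -> Prop) : open (fun x => locally x A).
Proof. intros x hx; now apply locally_locally. Qed.

Lemma iter_preimage_open (S : Y -> Y) :
  (forall V, open V -> open (fun y => V (S y))) ->
  forall n V, open V -> open (fun y => V (Nat.iter n S y)).
Proof.
intros hS n; induction n as [| n IH]; intros V hV; [exact hV |].
exact (IH _ (hS V hV)).
Qed.

(* Birkhoff transitivity: nested balls [ball (x j) (r j)] such that some
   iterate maps the [j]-th one into the [j]-th set of a countable base. *)
Lemma transitive_hypercyclic (S : Y -> Y) :
  seq_complete -> separable Y ->
  (forall V, open V -> open (fun y => V (S y))) ->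
  (forall U V : Y -> Prop, open U -> open V -> (exists y, U y) ->
     (exists y, V y) -> exists n y, U y /\ V (Nat.iter n S y)) ->
  hypercyclic S.
Proof.
intros hC [u hu] hS hT.
set (rad := fun b => mkposreal (/ (INR b + 1)) (RinvN_pos b)).
set (B := fun j => ball (u (fst (of_nat j))) (rad (snd (of_nat j)))).
(* The last clause uses the doubled radius because the limit of the centres will only be known to
   lie within twice each radius. *)
assert (step : forall js : nat * (Y * posreal), exists s : Y * posreal,
  ball (fst (snd js)) (snd (snd js) / 2) (fst s) /\
  snd s <= snd (snd js) / 2 /\
  exists n, forall y, ball (fst s) (2 * snd s) y -> B (fst js) (Nat.iter n S y)).
{ intros [j [x r]]; simpl.
  destruct (hT (fun y => locally y (ball x (pos_div_2 r)))
               (fun y => locally y (B j)))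
    as (n & y & hy & hn).
  - apply open_locally.
  - apply open_locally.
  - exists x; apply locally_ball.
  - exists (u (fst (of_nat j))); apply locally_ball.
  - destruct (iter_preimage_open S hS n _ (open_locally (B j)) y hn)
      as [d hd].
    assert (hm : 0 < Rmin (r / 2) (d / 2)).
    { apply Rmin_pos; [generalize (cond_pos r) | generalize (cond_pos d)]; lra. }
    exists (y, mkposreal _ hm); simpl; split; [| split; [apply Rmin_l |]].
    + exact (locally_singleton _ _ hy).
    + exists n; intros z hz; apply locally_singleton, hd.
      apply ball_le with (2 := hz).
      generalize (Rmin_r (r / 2) (d / 2)); lra. }
destruct (functional_choice _ step) as [f hf].
set (s := fix s j := match j with
  | O => (u O, mkposreal 1 Rlt_0_1) | Datatypes.S i => f (i, s i) end).
assert (hs : forall j, ball (fst (s j)) (snd (s j) / 2) (fst (s (Datatypes.S j)))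
  /\ snd (s (Datatypes.S j)) <= snd (s j) / 2 /\
  exists n, forall y, ball (fst (s (Datatypes.S j))) (2 * snd (s (Datatypes.S j))) y ->
    B j (Nat.iter n S y)).
{ intros j; exact (hf (j, s j)). }
assert (nest : forall j i y, ball (fst (s (i + j)%nat)) (snd (s (i + j)%nat)) y ->
  ball (fst (s j)) (snd (s j)) y).
{ intros j i; induction i as [| i IH]; intros y hy; [exact hy |].
  apply IH; destruct (hs (i + j)%nat) as (h1 & h2 & _).
  replace (pos (snd (s (i + j)%nat))) with
    (snd (s (i + j)%nat) / 2 + snd (s (i + j)%nat) / 2) by lra.
  eapply ball_triangle; [exact h1 |]; eapply ball_le; [exact h2 | exact hy]. }
assert (cent : forall j m, (j <= m)%nat ->
  ball (fst (s j)) (snd (s j)) (fst (s m))).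
{ intros j m hm; apply (nest j (m - j)%nat).
  replace (m - j + j)%nat with m by lia; apply ball_center. }
(* Halving at each stage gives the crude bound [1/j] on the radii, which suffices for the Cauchy
   property. *)
assert (small : forall j, INR j * snd (s j) <= 1).
{ intros j; induction j as [| j IH]; [simpl; lra |].
  rewrite S_INR; destruct (hs j) as (_ & h & _).
  destruct j as [| j]; [simpl in *; lra |].
  rewrite S_INR in *; generalize (pos_INR j) (cond_pos (snd (s (Datatypes.S (Datatypes.S j))))); nra. }
destruct (hC (fun j => fst (s j))) as [l hl].
{ intros eps.
  destruct (nfloor_ex (2 / eps)) as [N hN].
  { generalize (cond_pos eps); intros; apply Rlt_le, Rdiv_lt_0_compat; lra. }
  assert (hr : snd (s (Datatypes.S N)) <= eps / 2).
  { generalize (small (Datatypes.S N)) (cond_pos eps) (pos_INR N); rewrite S_INR.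
    destruct hN as [_ hN]; intros.
    assert (2 < (INR N + 1) * eps).
    { apply Rmult_lt_compat_r with (r := eps) in hN; [| lra].
      unfold Rdiv in hN; rewrite Rmult_assoc, Rinv_l in hN; lra. }
    generalize (cond_pos (snd (s (Datatypes.S N)))); nra. }
  exists (Datatypes.S N); intros n m hn hm.
  replace (pos eps) with (eps / 2 + eps / 2) by lra.
  apply ball_triangle with (fst (s (Datatypes.S N))).
  - apply ball_sym; eapply ball_le; [exact hr | now apply cent].
  - eapply ball_le; [exact hr | now apply cent]. }
assert (hlj : forall j, ball (fst (s j)) (2 * snd (s j)) l).
{ intros j; destruct (hl (snd (s j))) as [N hN].
  replace (2 * snd (s j)) with (snd (s j) + snd (s j)) by ring.
  apply ball_triangle with (fst (s (Nat.max N j))); [apply cent; lia |].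
  apply hN; lia. }
exists l; intros V hV [y hy].
destruct (hV y hy) as [eps heps].
destruct (hu (fun z => locally z (ball y (pos_div_2 eps))))
  as (z & hz & a & ->).
{ apply open_locally. }
{ exists y; apply locally_ball. }
apply locally_singleton in hz; simpl in hz.
destruct (nfloor_ex (2 / eps)) as [b [_ hb]].
{ generalize (cond_pos eps); intros; apply Rlt_le, Rdiv_lt_0_compat; lra. }
(* The stage coded by [(a, b)] puts an iterate of [l] within [1/(b+1) < eps/2] of [u a], which is
   itself within [eps/2] of [y]. *)
destruct (hs (to_nat (a, b))) as (_ & _ & n & hn).
specialize (hn l (hlj _)); unfold B in hn; rewrite cancel_of_to in hn.
simpl in hn.
exists (Nat.iter n S l); split; [| now exists n].
apply heps; replace (pos eps) with (eps / 2 + eps / 2) by lra.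
eapply ball_triangle; [exact hz |]; eapply ball_le; [| exact hn].
assert (0 < 2 / eps) by (apply Rdiv_lt_0_compat; [lra | apply cond_pos]).
replace (eps / 2) with (/ (2 / eps)) by (field; generalize (cond_pos eps); lra).
apply Rlt_le, Rinv_lt_contravar; [apply Rmult_lt_0_compat |]; lra.
Qed.

End Baire.

(** * Norm estimates, closures and null sequences *)

Section Groups.

Context {G : AbelianGroup}.

Lemma minus_plus_plus (a b c d : G) :
  minus (plus a b) (plus c d) = plus (minus a c) (minus b d).
Proof.
unfold minus; rewrite opp_plus, <- !plus_assoc; f_equal.
rewrite !plus_assoc; f_equal; apply plus_comm.
Qed.

Lemma minus_zero_r (a : G) : minus a zero = a.
Proof. unfold minus; now rewrite opp_zero, plus_zero_r. Qed.

End Groups.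

Section Adherence.

Context {K : AbsRing} {V : NormedModule K}.

(** Uniform balls and norm balls agree only up to [norm_factor], hence the division of the
    radius. *)
Lemma ball_norm_locally (x : V) (A : V -> Prop) (eps : R) : 0 < eps ->
  (forall y, norm (minus y x) < eps -> A y) -> locally x A.
Proof.
intros he h; assert (hf := norm_factor_gt_0 (V := V)).
assert (hd : 0 < eps / norm_factor (V := V)) by now apply Rdiv_lt_0_compat.
exists (mkposreal _ hd); intros y hy; apply h.
apply norm_compat2 in hy; simpl in hy.
replace (norm_factor * (eps / norm_factor)) with eps in hy by (field; lra).
exact hy.
Qed.

Lemma norm_minus_self (x : V) : norm (minus x x) = 0.
Proof. rewrite minus_eq_zero; apply (norm_zero (V := V)). Qed.

Lemma norm_minus_sym (a b : V) : norm (minus a b) = norm (minus b a).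
Proof. now rewrite <- norm_opp, opp_minus. Qed.

Lemma norm_minus_trans (a b c : V) :
  norm (minus a c) <= norm (minus a b) + norm (minus b c).
Proof. rewrite (minus_trans b a c); apply norm_triangle. Qed.

Lemma norm_minus_plus (a b c d : V) :
  norm (minus (plus a b) (plus c d)) <= norm (minus a c) + norm (minus b d).
Proof.
apply Rle_trans with (norm (plus (minus a c) (minus b d))).
{ right; exact (f_equal norm (minus_plus_plus (G := V) a b c d)). }
apply norm_triangle.
Qed.

Definition adherent (A : V -> Prop) (x : V) : Prop :=
  forall eps, 0 < eps -> exists a, A a /\ norm (minus a x) < eps.

Lemma adherent_in (A : V -> Prop) x : A x -> adherent A x.
Proof.
intros h eps he; exists x; split; [exact h |].
now rewrite norm_minus_self.
Qed.

Lemma adherent_trans (A : V -> Prop) x : adherent (adherent A) x -> adherent A x.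
Proof.
intros h eps he; destruct (h (eps / 2)) as (b & hb & hbx); [lra |].
destruct (hb (eps / 2)) as (a & ha & hab); [lra |].
exists a; split; [exact ha |].
generalize (norm_minus_trans a b x); lra.
Qed.

Lemma adherent_plus (A : V -> Prop) :
  (forall a b, A a -> A b -> A (plus a b)) ->
  forall x y, adherent A x -> adherent A y -> adherent A (plus x y).
Proof.
intros hA x y hx hy eps he.
destruct (hx (eps / 2)) as (a & ha & hax); [lra |].
destruct (hy (eps / 2)) as (b & hb & hby); [lra |].
exists (plus a b); split; [now apply hA |].
generalize (norm_minus_plus a b x y); lra.
Qed.

Lemma dense_adherent (A : V -> Prop) : dense A <-> forall x, adherent A x.
Proof.
split.
- intros h x eps he.
  destruct (h (fun y => norm (minus y x) < eps)) as (a & ha & hA).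
  + intros y hy; apply (ball_norm_locally _ _ (eps - norm (minus y x))); [lra |].
    intros z hz; generalize (norm_minus_trans z y x); lra.
  + exists x; now rewrite norm_minus_self.
  + now exists a.
- intros h U hU [y hy]; destruct (hU y hy) as [eps heps].
  destruct (h y eps (cond_pos eps)) as (a & ha & hay).
  exists a; split; [| exact ha].
  now apply heps, norm_compat1.
Qed.

Definition tends_zero (u : nat -> V) : Prop :=
  forall eps, 0 < eps -> eventually (fun n => norm (u n) < eps).

Lemma tends_zero_cst : tends_zero (fun _ => zero).
Proof. intros eps he; exists O; intros _ _.
rewrite (norm_zero (V := V)); exact he. Qed.

Lemma tends_zero_plus (u v : nat -> V) :
  tends_zero u -> tends_zero v -> tends_zero (fun n => plus (u n) (v n)).
Proof.
intros hu hv eps he.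
destruct (hu (eps / 2)) as [N hN]; [lra |].
destruct (hv (eps / 2)) as [N' hN']; [lra |].
exists (Nat.max N N'); intros n hn.
eapply Rle_lt_trans; [apply norm_triangle |].
generalize (hN n ltac:(lia)) (hN' n ltac:(lia)); lra.
Qed.

Lemma tends_zero_scal (a : K) (u : nat -> V) :
  tends_zero u -> tends_zero (fun n => scal a (u n)).
Proof.
intros hu eps he; assert (ha := abs_ge_0 a).
destruct (hu (eps / (abs a + 1))) as [N hN].
{ apply Rdiv_lt_0_compat; lra. }
exists N; intros n hn; specialize (hN n hn).
eapply Rle_lt_trans; [apply norm_scal |].
apply Rmult_lt_compat_l with (r := abs a + 1) in hN; [| lra].
replace ((abs a + 1) * (eps / (abs a + 1))) with eps in hN by (field; lra).
generalize (norm_ge_0 (u n)); lra.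
Qed.

Lemma tends_zero_ext (u v : nat -> V) :
  (forall n, u n = v n) -> tends_zero u -> tends_zero v.
Proof.
intros h hu eps he; destruct (hu eps he) as [N hN].
exists N; intros n hn; rewrite <- h; now apply hN.
Qed.

End Adherence.

(** * Integer positions and an enumeration of the index set *)

Section Indices.

Context {J : index}.

(** Embedding both index sets into the integers reduces questions about indices to linear
    arithmetic. For [Naturals] positions start at 0. *)
Definition ipos : J -> Z :=
  match J with Naturals => Z.of_nat | Integers => fun k => k end.

(* The sets [{k | irank k < n}] are finite and exhaust [J]. *)
Definition irank : J -> nat :=
  match J with
  | Naturals => fun k => k
  | Integers => fun k =>
      if (0 <=? k)%Z then Z.to_nat (2 * k) else Z.to_nat (-2 * k - 1)
  end.

Lemma ipos_inj (k l : J) : ipos k = ipos l -> k = l.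
Proof. unfold ipos; destruct J; simpl; lia. Qed.

Lemma ipos_isucc (k : J) : ipos (isucc k) = (ipos k + 1)%Z.
Proof. unfold ipos, isucc; destruct J; simpl; lia. Qed.

Lemma ipos_iter n (k : J) : ipos (Nat.iter n isucc k) = (ipos k + Z.of_nat n)%Z.
Proof.
induction n as [| n IH]; [simpl; lia |].
rewrite Nat2Z.inj_succ; simpl; rewrite ipos_isucc, IH; lia.
Qed.

Lemma ipos_le_iabs (k : J) : (Z.abs (ipos k) <= Z.of_nat (iabs k))%Z.
Proof. unfold ipos, iabs; destruct J; simpl in *; lia. Qed.

Lemma irank_inj (k l : J) : irank k = irank l -> k = l.
Proof.
unfold irank; destruct J; cbn [idx] in *; [easy |].
destruct (Z.leb_spec 0 k); destruct (Z.leb_spec 0 l); lia.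
Qed.

Lemma irank_le (k : J) : (Z.of_nat (irank k) <= 2 * Z.abs (ipos k))%Z.
Proof.
unfold irank, ipos; destruct J; cbn [idx] in *; [lia |].
destruct (Z.leb_spec 0 k); lia.
Qed.

Lemma ile_ipos (k l : J) : ile k l <-> (ipos k <= ipos l)%Z.
Proof. unfold ile, ipos; destruct J; simpl in *; lia. Qed.

Lemma ilt_ipos (k l : J) : ilt k l <-> (ipos k < ipos l)%Z.
Proof. unfold ilt, ipos; destruct J; simpl in *; lia. Qed.

Lemma irank_max (l : list J) : exists n, forall k, In k l -> (irank k < n)%nat.
Proof.
induction l as [| a l [n hn]]; [exists O; easy |].
exists (Nat.max n (S (irank a))); intros k [<- | hk]; [lia |].
specialize (hn k hk); lia.
Qed.

Lemma ipos_max (l : list J) : exists n, forall k, In k l -> (Z.abs (ipos k) < n)%Z.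
Proof.
induction l as [| a l [n hn]]; [now exists 0%Z |].
exists (Z.max n (Z.abs (ipos a) + 1)); intros k [<- | hk]; [lia |].
specialize (hn k hk); lia.
Qed.

End Indices.

(** * Restriction of sequences to sets of coordinates, and regular sequence spaces *)

Section Restriction.

Context {K : AbsRing} {J : index} {X : J -> CompleteNormedModule K}.

Lemma norm_zero_coord k : norm (zero : X k) = 0.
Proof. exact (norm_zero (V := X k)). Qed.

Definition restrict (P : J -> Prop) (x : pseq X) : pseq X :=
  fun k => if excluded_middle_informative (P k) then x k else zero.

Lemma restrict_in (P : J -> Prop) x k : P k -> restrict P x k = x k.
Proof. unfold restrict; now destruct (excluded_middle_informative _). Qed.

Lemma restrict_out (P : J -> Prop) x k : ~ P k -> restrict P x k = zero.
Proof. unfold restrict; now destruct (excluded_middle_informative _). Qed.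

Lemma restrict_ext (P Q : J -> Prop) x :
  (forall k, P k <-> Q k) -> restrict P x = restrict Q x.
Proof.
intros h; apply functional_extensionality_dep; intros k; unfold restrict.
destruct (excluded_middle_informative (P k)), (excluded_middle_informative (Q k));
  try reflexivity; now destruct (h k); exfalso; auto.
Qed.

Lemma norm_restrict_le (P : J -> Prop) (x : pseq X) k :
  norm (restrict P x k) <= norm (x k).
Proof.
unfold restrict; destruct (excluded_middle_informative _); [lra |].
rewrite norm_zero_coord; apply (norm_ge_0 (x k)).
Qed.

Lemma restrict_plus (P : J -> Prop) x y :
  restrict P (pplus X x y) = pplus X (restrict P x) (restrict P y).
Proof.
apply functional_extensionality_dep; intros k; unfold restrict, pplus.
destruct (excluded_middle_informative _); [reflexivity |].
symmetry; apply (plus_zero_l (G := X k)).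
Qed.

Lemma restrict_disjoint_union (P Q R : J -> Prop) x :
  (forall k, R k <-> P k \/ Q k) -> (forall k, P k -> ~ Q k) ->
  restrict R x = pplus X (restrict P x) (restrict Q x).
Proof.
intros h d; apply functional_extensionality_dep; intros k; unfold pplus.
destruct (classic (P k)) as [hP | hP].
- rewrite (restrict_in P), (restrict_out Q), restrict_in by (try apply h; auto).
  symmetry; apply (plus_zero_r (G := X k)).
- rewrite (restrict_out P) by assumption.
  rewrite (plus_zero_l (G := X k)).
  destruct (classic (Q k)) as [hQ | hQ].
  + now rewrite (restrict_in Q), restrict_in by (try apply h; auto).
  + rewrite (restrict_out Q), restrict_out; auto.
    rewrite h; tauto.
Qed.

Lemma exists_single (k : J) (a : X k) :
  exists x : pseq X, x k = a /\ forall m, m <> k -> x m = zero.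
Proof.
(* The fibres depend on the index, so [a] is transported along [k = m]; at [m = k] proof irrelevance
   makes the transport trivial. *)
exists (fun m => match excluded_middle_informative (k = m) with
  | left e => eq_rect k (fun i => X i : Type) a m e | right _ => zero end); split.
- destruct (excluded_middle_informative (k = k)) as [e | h]; [| easy].
  now rewrite (proof_irrelevance _ e eq_refl).
- intros m hm; destruct (excluded_middle_informative (k = m)); congruence.
Qed.

End Restriction.

(* What the argument uses of the spaces [lp] and [c0]. *)
Record regular {K : AbsRing} {J : index} {X : J -> CompleteNormedModule K}
    (E : seq_space X) : Prop := {
  reg_dominated : forall x y, mem E x -> (forall k, norm (y k) <= norm (x k)) ->
    mem E y /\ snorm E y <= snorm E x;
  reg_coord : forall x k, mem E x -> norm (x k) <= snorm E x;
  reg_single : forall x k, (forall m, m <> k -> x m = zero) ->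
    mem E x /\ snorm E x <= norm (x k);
  reg_tail : forall x eps, mem E x -> 0 < eps ->
    exists n : Z, forall P : J -> Prop,
      (forall m, P m -> (n <= Z.abs (ipos m))%Z) -> snorm E (restrict P x) < eps;
  reg_shift : forall T : (forall k, X (isucc k) -> X k),
    (exists M, forall k, Rbar_le (op_norm (T k)) (Finite M)) ->
    exists C, 0 <= C /\ forall x, mem E x -> snorm E (pshift T x) <= C * snorm E x;
  reg_limit : forall y,
    (forall eps, 0 < eps -> exists z, mem E z /\ forall n,
       snorm E (restrict (fun k => (irank k < n)%nat) (pplus X y (popp X z))) <= eps) ->
    mem E y
}.

Section Finite.

Context {K : AbsRing} {J : index} {X : J -> CompleteNormedModule K}.
Context (E : seq_space X).
Context (single : forall (x : pseq X) k, (forall m, m <> k -> x m = zero) ->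
    mem E x).

(** [irank] is injective, so at most one coordinate survives. *)
Lemma mem_restrict_rank_eq n (x : pseq X) :
  mem E (restrict (fun k => irank k = n) x).
Proof.
destruct (classic (exists k : J, irank k = n)) as [[k hk] | h].
- apply (single _ k); intros m hm; apply restrict_out.
  intros e; apply hm, irank_inj; congruence.
- replace (restrict _ x) with (pzero X); [apply mem_zero |].
  apply functional_extensionality_dep; intros k; symmetry.
  apply restrict_out; intros e; apply h; now exists k.
Qed.

Lemma restrict_rank_S n (x : pseq X) :
  restrict (fun k => (irank k < S n)%nat) x =
  pplus X (restrict (fun k => (irank k < n)%nat) x)
          (restrict (fun k => irank k = n) x).
Proof. apply restrict_disjoint_union; intros k; lia. Qed.

Lemma restrict_rank_0 (x : pseq X) :
  restrict (fun k => (irank k < 0)%nat) x = pzero X.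
Proof.
apply functional_extensionality_dep; intros k; apply restrict_out; lia.
Qed.

(** Derived from the single-coordinate property alone, so that it is available while [regular] is
    still being proved for [lp] and [c0]. *)
Lemma mem_restrict_rank n (x : pseq X) :
  mem E (restrict (fun k => (irank k < n)%nat) x).
Proof.
induction n as [| n IH].
- rewrite restrict_rank_0; apply mem_zero.
- rewrite restrict_rank_S; apply mem_plus; [exact IH | apply mem_restrict_rank_eq].
Qed.

End Finite.

(** * Regularity of the spaces of p-summable sequences *)

Section LpRegular.

Context {K : AbsRing} {J : index} (X : J -> CompleteNormedModule K).
Context (p : R) (hp : 1 <= p).

(** In a list without repetitions [k] contributes at most once. *)
Lemma lsum_single {I : Type} (f : I -> R) k l : NoDup l ->
  (forall m, m <> k -> f m = 0) -> 0 <= f k -> lsum f l <= f k.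
Proof.
intros hl hf hk.
assert (h0 : ~ In k l -> lsum f l = 0).
{ induction l as [| a l IH]; simpl; [easy |]; intros h.
  inversion_clear hl; rewrite hf, IH; auto; lra. }
induction hl as [| a l ha hl IH]; simpl; [exact hk |].
destruct (classic (a = k)) as [-> | hak].
- assert (h : lsum f l = 0); [| lra].
  clear h0 IH; induction l as [| b l IH]; simpl; [easy |].
  simpl in ha; inversion_clear hl.
  rewrite hf, IH; auto; lra.
- rewrite hf by assumption.
  destruct (classic (In k l)) as [h | h].
  + rewrite Rplus_0_l; apply IH; easy.
  + assert (e := h0); simpl in e; rewrite hf in e by assumption.
    rewrite e; [lra | tauto].
Qed.

Lemma lsum_app {I : Type} (f : I -> R) l l' :
  lsum f (l ++ l') = lsum f l + lsum f l'.
Proof. induction l as [| a l IH]; simpl; [ring | rewrite IH; ring]. Qed.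

Lemma lsum_ext_in {I : Type} (f g : I -> R) l :
  (forall k, In k l -> f k = g k) -> lsum f l = lsum g l.
Proof.
intros h; induction l as [| a l IH]; simpl; [reflexivity |].
rewrite h, IH by (simpl in *; auto); reflexivity.
Qed.

Lemma rpow_lt_pos t : 0 < t -> 0 < rpow t p.
Proof. intros h; rewrite rpow_pos by assumption; apply exp_pos. Qed.

Lemma lp_single (x : pseq X) k : (forall m, m <> k -> x m = zero) ->
  in_lp X p x /\ lp_norm X p x <= norm (x k).
Proof.
intros hx; apply (lp_bound X p hp); [apply norm_ge_0 |]; intros l hl.
apply (lsum_single (fun k => rpow (norm (x k)) p) k l hl).
- intros m hm; rewrite hx by assumption.
  now rewrite norm_zero_coord, rpow_0.
- apply rpow_ge0.
Qed.

Lemma lp_dominated (x y : pseq X) : in_lp X p x ->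
  (forall k, norm (y k) <= norm (x k)) ->
  in_lp X p y /\ lp_norm X p y <= lp_norm X p x.
Proof.
intros hx h; apply (lp_bound X p hp); [apply lp_norm_ge0 |]; intros l hl.
eapply Rle_trans; [| apply (lp_norm_sum X p hp x hx l hl)].
apply lsum_le; intros k; apply rpow_le; [lra | split; [apply norm_ge_0 | apply h]].
Qed.

Lemma lp_coord (x : pseq X) k : in_lp X p x -> norm (x k) <= lp_norm X p x.
Proof.
intros hx; assert (hk : NoDup (k :: nil)) by (constructor; [easy | constructor]).
assert (h := lp_norm_sum X p hp x hx _ hk); simpl in h; rewrite Rplus_0_r in h.
rewrite <- (rpow_inv (norm (x k)) p (/ p)) by (try apply norm_ge_0; field; lra).
rewrite <- (rpow_inv (lp_norm X p x) p (/ p))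
  by (try apply lp_norm_ge0; field; lra).
apply rpow_le; [apply Rlt_le, Rinv_0_lt_compat; lra |].
split; [apply rpow_ge0 | exact h].
Qed.

(** Some finite list [l] carries the whole sum up to [(eps/2)^p]; a finite family of indices
    disjoint from [l] can then add at most that much. *)
Lemma lp_tail (x : pseq X) eps : in_lp X p x -> 0 < eps ->
  exists n : Z, forall P : J -> Prop,
    (forall m, P m -> (n <= Z.abs (ipos m))%Z) -> lp_norm X p (restrict P x) < eps.
Proof.
intros hx he; set (f := fun k => rpow (norm (x k)) p).
assert (hd : 0 < rpow (eps / 2) p) by (apply rpow_lt_pos; lra).
set (d := rpow (eps / 2) p) in *.
assert (hl : exists l, NoDup l /\ real (fam_sum f) - d < lsum f l).
{ apply NNPP; intros hn.
  assert (h : Rbar_le (fam_sum f) (real (fam_sum f) - d)).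
  { apply fam_sum_le; intros l hl; apply Rnot_lt_le; intros hlt.
    apply hn; now exists l. }
  rewrite fam_sum_finite in h at 1 by exact hx; simpl in h; lra. }
destruct hl as (l & hl & hs).
destruct (ipos_max l) as [n hn]; exists n; intros P hP.
apply Rle_lt_trans with (eps / 2); [| lra].
apply (lp_bound X p hp); [lra |]; fold d; intros l' hl'.
(* Indices outside [P] contribute zero. Those in [P] have position at least [n] in absolute value,
   hence are not in [l], and [l ++ l''] is an admissible list for the total sum. *)
set (l'' := filter (fun k =>
  if excluded_middle_informative (P k) then true else false) l').
assert (e : lsum (fun k => rpow (norm (restrict P x k)) p) l' = lsum f l'').
{ unfold l''; clear; induction l' as [| a l' IH]; simpl; [reflexivity |].
  rewrite IH; unfold restrict at 1.
  destruct (excluded_middle_informative (P a)); [reflexivity |].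
  rewrite norm_zero_coord, rpow_0; ring. }
rewrite e.
assert (hd' : NoDup (l ++ l'')).
{ apply NoDup_app; [exact hl | now apply NoDup_filter |].
  intros a ha ha'; apply filter_In in ha'; destruct ha' as [_ ha'].
  destruct (excluded_middle_informative (P a)) as [hPa |]; [| easy].
  specialize (hP a hPa); specialize (hn a ha); lia. }
assert (h := lsum_le_fam_sum f _ hd'); rewrite lsum_app in h.
rewrite fam_sum_finite in h by exact hx; simpl in h; lra.
Qed.

Lemma lp_shift_bound (T : forall k, X (isucc k) -> X k) :
  (exists M, forall k, Rbar_le (op_norm (T k)) (Finite M)) ->
  exists C, 0 <= C /\
    forall x, in_lp X p x -> lp_norm X p (pshift T x) <= C * lp_norm X p x.
Proof.
intros [M hM]; exists (Rmax M 0); set (M' := Rmax M 0).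
assert (hM0 : 0 <= M') by apply Rmax_r.
split; [exact hM0 |]; intros x hx.
apply (lp_bound X p hp).
{ apply Rmult_le_pos; [assumption | apply lp_norm_ge0]. }
intros l hl; rewrite rpow_mult by (try apply lp_norm_ge0; assumption).
apply Rle_trans with
  (rpow M' p * lsum (fun k => rpow (norm (x k)) p) (map isucc l)).
- rewrite lsum_map, <- lsum_mult; apply lsum_le; intros k.
  rewrite <- rpow_mult by (try apply norm_ge_0; assumption).
  apply rpow_le; [lra | split; [apply norm_ge_0 |]].
  eapply Rle_trans; [apply (op_norm_bound _ _ (hM k)) |].
  apply Rmult_le_compat_r; [apply norm_ge_0 | apply Rmax_l].
- apply Rmult_le_compat_l; [apply rpow_ge0 |].
  apply lp_norm_sum; [assumption | assumption |].
  now apply FinFun.Injective_map_NoDup; [intros k n; apply isucc_inj |].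
Qed.

Lemma lp_regular : regular (lp X p hp).
Proof.
split; simpl.
- exact lp_dominated.
- exact lp_coord.
- exact lp_single.
- exact lp_tail.
- exact lp_shift_bound.
(* A single approximant suffices here: the finite sums of [y - z] are bounded by 1, so [y - z] is
   p-summable, and so is [y = (y - z) + z]. *)
- intros y h; destruct (h 1 Rlt_0_1) as (z & hz & hyz).
  replace y with (pplus X (pplus X y (popp X z)) z).
  2: { apply functional_extensionality_dep; intros k; unfold pplus, popp.
       rewrite <- (plus_assoc (G := X k)), (plus_opp_l (G := X k)).
       apply (plus_zero_r (G := X k)). }
  apply (lp_plus X p hp); [| exact hz].
  apply (lp_bound X p hp _ 1); [lra |]; intros l hl.
  destruct (irank_max l) as [n hn].
  apply Rle_trans with (lsum (fun k => rpow (norm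
    (restrict (fun k => (irank k < n)%nat) (pplus X y (popp X z)) k)) p) l).
  + right; apply lsum_ext_in; intros k hk; now rewrite restrict_in by auto.
  + eapply Rle_trans; [apply (lp_norm_sum X p hp); [| exact hl] |].
    * apply (mem_restrict_rank (lp X p hp)); intros x k hx; now apply (lp_single x k).
    * apply rpow_le; [lra |]; split; [apply lp_norm_ge0 | apply hyz].
Qed.

End LpRegular.

(** * Regularity of the space of null sequences *)

Section C0Regular.

Context {K : AbsRing} {J : index} (X : J -> CompleteNormedModule K).

Lemma c0_single (x : pseq X) k : (forall m, m <> k -> x m = zero) ->
  in_c0 X x /\ c0_norm X x <= norm (x k).
Proof.
intros hx; split.
- intros eps; exists (S (iabs k)); intros m hm; rewrite hx.
  + rewrite norm_zero_coord; apply cond_pos.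
  + intros ->; lia.
- apply c0_norm_le; intros m; destruct (classic (m = k)) as [-> | h]; [lra |].
  rewrite hx by assumption; rewrite norm_zero_coord; apply norm_ge_0.
Qed.

Lemma c0_dominated_norm (x y : pseq X) : in_c0 X x ->
  (forall k, norm (y k) <= norm (x k)) ->
  in_c0 X y /\ c0_norm X y <= c0_norm X x.
Proof.
intros hx h; split.
- apply (c0_dominated X x y 1); [intros k; rewrite Rmult_1_l; apply h | exact hx].
- apply c0_norm_le; intros k; eapply Rle_trans; [apply h | now apply le_c0_norm].
Qed.

Lemma c0_tail (x : pseq X) eps : in_c0 X x -> 0 < eps ->
  exists n : Z, forall P : J -> Prop,
    (forall m, P m -> (n <= Z.abs (ipos m))%Z) -> c0_norm X (restrict P x) < eps.
Proof.
intros hx he; assert (he2 : 0 < eps / 2) by lra.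
destruct (hx (mkposreal _ he2)) as [N hN]; simpl in hN.
exists (Z.of_nat N); intros P hP; apply Rle_lt_trans with (eps / 2); [| lra].
apply c0_norm_le; intros k; destruct (classic (P k)) as [h | h].
- rewrite restrict_in by assumption; apply Rlt_le, hN.
  generalize (hP k h) (ipos_le_iabs k); lia.
- rewrite restrict_out, norm_zero_coord by assumption; lra.
Qed.

Lemma c0_shift_bound (T : forall k, X (isucc k) -> X k) :
  (exists M, forall k, Rbar_le (op_norm (T k)) (Finite M)) ->
  exists C, 0 <= C /\
    forall x, in_c0 X x -> c0_norm X (pshift T x) <= C * c0_norm X x.
Proof.
intros [M hM]; exists (Rmax M 0); assert (hM0 : 0 <= Rmax M 0) by apply Rmax_r.
split; [exact hM0 |]; intros x hx; apply c0_norm_le; intros k.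
eapply Rle_trans; [apply (op_norm_bound _ _ (hM k)) |].
apply Rle_trans with (Rmax M 0 * norm (x (isucc k))).
- apply Rmult_le_compat_r; [apply norm_ge_0 | apply Rmax_l].
- apply Rmult_le_compat_l; [exact hM0 | now apply le_c0_norm].
Qed.

Lemma c0_regular : regular (c0 X).
Proof.
split; simpl.
- exact c0_dominated_norm.
- intros x k hx; now apply le_c0_norm.
- exact c0_single.
- exact c0_tail.
- exact c0_shift_bound.
(* Bounded truncations do not force decay, so the approximant must depend on [eps]: each coordinate
   of [y - z] is at most [eps/3], and those of [z] are eventually below [eps/3]. *)
- intros y h eps.
  destruct (h (eps / 3)) as (z & hz & hyz); [generalize (cond_pos eps); lra |].
  assert (he : 0 < eps / 3) by (generalize (cond_pos eps); lra).
  destruct (hz (mkposreal _ he)) as [N hN]; simpl in hN.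
  exists N; intros k hk; specialize (hN k hk).
  assert (hd : norm (minus (y k) (z k)) <= eps / 3).
  { eapply Rle_trans; [| apply (hyz (S (irank k)))].
    eapply Rle_trans; [| apply (le_c0_norm _ _ k)].
    - rewrite restrict_in by lia; apply Rle_refl.
    - apply (mem_restrict_rank (c0 X)); intros x i hx; now apply (c0_single x i). }
  assert (ht := norm_minus_trans (y k) (z k) zero).
  rewrite !(minus_zero_r (G := X k)) in ht.
  eapply Rle_lt_trans; [exact ht |].
  eapply Rle_lt_trans; [apply Rplus_le_compat_r; exact hd |]; lra.
Qed.

End C0Regular.

(** * Approximation, separability and completeness of regular spaces *)

Section RegularSpace.

Context {K : AbsRing} {J : index} {X : J -> CompleteNormedModule K}.
Context (E : seq_space X) (hE : regular E).

Definition coord (x : E) : pseq X := proj1_sig x.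

Lemma coord_mem (x : E) : mem E (coord x).
Proof. exact (proj2_sig x). Qed.

Lemma coord_inj (x y : E) : (forall k, coord x k = coord y k) -> x = y.
Proof. exact (elt_eq E x y). Qed.

Lemma norm_coord (x : E) k : norm (coord x k) <= norm x.
Proof. exact (reg_coord E hE _ k (coord_mem x)). Qed.

Lemma mem_restrict (P : J -> Prop) (x : pseq X) : mem E x -> mem E (restrict P x).
Proof.
intros hx; apply (reg_dominated E hE x _ hx); intros k; apply norm_restrict_le.
Qed.

Definition cut (P : J -> Prop) (x : E) : E :=
  exist _ (restrict P (coord x)) (mem_restrict P _ (coord_mem x)).

Lemma coord_cut (P : J -> Prop) (x : E) : coord (cut P x) = restrict P (coord x).
Proof. reflexivity. Qed.

Lemma norm_cut_le (P : J -> Prop) (x : E) : norm (cut P x) <= norm x.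
Proof.
apply (reg_dominated E hE (coord x) _ (coord_mem x)); intros k.
apply norm_restrict_le.
Qed.

Lemma norm_single (x : E) k : (forall m, m <> k -> coord x m = zero) ->
  norm x <= norm (coord x k).
Proof. exact (fun h => proj2 (reg_single E hE (coord x) k h)). Qed.

Lemma exists_elt_single k (a : X k) :
  exists x : E, coord x k = a /\ forall m, m <> k -> coord x m = zero.
Proof.
destruct (exists_single k a) as (x & hk & hx).
now exists (exist _ x (proj1 (reg_single E hE x k hx))).
Qed.

Lemma norm_cut_tail (x : E) eps : 0 < eps ->
  exists n : Z, forall P : J -> Prop,
    (forall m, P m -> (n <= Z.abs (ipos m))%Z) -> norm (cut P x) < eps.
Proof. exact (reg_tail E hE _ eps (coord_mem x)). Qed.

(** Source of the null sequences for Kitai's criterion: cuts of a fixed vector to sets that leave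
    every bounded range of positions. *)
Lemma tends_zero_cut (x : E) (P : nat -> J -> Prop) :
  (forall b, eventually (fun n => forall m, P n m -> (b <= Z.abs (ipos m))%Z)) ->
  tends_zero (fun n => cut (P n) x).
Proof.
intros h eps he; destruct (norm_cut_tail x eps he) as [b hb].
destruct (h b) as [N hN]; exists N; intros n hn; apply hb; now apply hN.
Qed.

Definition below (n : nat) (k : J) : Prop := (irank k < n)%nat.

Lemma minus_cut (P Q : J -> Prop) (x : E) : (forall k, Q k <-> ~ P k) ->
  minus (cut P x) x = opp (cut Q x).
Proof.
intros h; apply coord_inj; intros k.
change (minus (restrict P (coord x) k) (coord x k) = opp (restrict Q (coord x) k)).
destruct (classic (P k)) as [hP | hP].
- rewrite (restrict_in P), (restrict_out Q) by (rewrite ?h; tauto).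
  rewrite (minus_eq_zero (G := X k)); symmetry; apply (opp_zero (G := X k)).
- rewrite (restrict_out P), (restrict_in Q) by (rewrite ?h; tauto).
  apply (plus_zero_l (G := X k)).
Qed.

Lemma norm_minus_cut (P Q : J -> Prop) (x : E) : (forall k, Q k <-> ~ P k) ->
  norm (minus (cut P x) x) = norm (cut Q x).
Proof. intros h; rewrite (minus_cut P Q x h); apply (norm_opp (V := E)). Qed.

Lemma cut_below_approx (x : E) eps : 0 < eps ->
  exists n, norm (minus (cut (below n) x) x) < eps.
Proof.
intros he; destruct (norm_cut_tail x eps he) as [b hb].
(* By [irank_le], rank at least [2 * b] forces a position of absolute value at least [b]. *)
exists (Z.to_nat (2 * b)).
rewrite (norm_minus_cut _ (fun k => ~ below (Z.to_nat (2 * b)) k))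
  by (intros k; tauto).
apply hb; unfold below; intros m hm; generalize (irank_le m); lia.
Qed.

Lemma cut_below_0 (x : E) : cut (below 0) x = zero.
Proof. apply coord_inj; intros k; apply restrict_out; unfold below; lia. Qed.

Lemma cut_below_S n (x : E) :
  cut (below (S n)) x = plus (cut (below n) x) (cut (fun k => irank k = n) x).
Proof.
apply coord_inj; intros k.
exact (f_equal (fun y => y k) (restrict_rank_S n (coord x))).
Qed.

Lemma cut_rank (x : E) n :
  (exists k, irank k = n /\ cut (fun k => irank k = n) x = cut (eq k) x) \/
  ((forall k : J, irank k <> n) /\ cut (fun k => irank k = n) x = zero).
Proof.
destruct (classic (exists k : J, irank k = n)) as [[k hk] | h]; [left | right].
- exists k; split; [exact hk |]; apply coord_inj; intros m.
  rewrite !coord_cut; apply (f_equal (fun s => s m)), restrict_ext; intros i.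
  split; [| congruence]; intros hi; apply irank_inj; congruence.
- split; [intros k hk; apply h; now exists k |].
  apply coord_inj; intros m; apply restrict_out; intros e; apply h; now exists m.
Qed.

(** Truncations to finitely many ranks approximate [x] and are finite sums of single-coordinate
    vectors; the closure of [A] is stable under sums. *)
Lemma dense_of_singles (A : E -> Prop) :
  A zero -> (forall x y, A x -> A y -> A (plus x y)) ->
  (forall k x, adherent A (cut (eq k) x)) -> dense A.
Proof.
intros h0 hp hs; apply dense_adherent; intros x; apply adherent_trans.
intros eps he; destruct (cut_below_approx x eps he) as [n hn].
exists (cut (below n) x); split; [clear hn | exact hn].
induction n as [| n IH].
- rewrite cut_below_0; now apply adherent_in.
- rewrite cut_below_S; apply adherent_plus; [exact hp | exact IH |].
  destruct (cut_rank x n) as [(k & _ & ->) | [_ ->]]; [apply hs |].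
  now apply adherent_in.
Qed.

Lemma minus_singles k (x y : E) :
  (forall m, m <> k -> coord x m = zero) ->
  norm (minus x (cut (eq k) y)) <= norm (minus (coord x k) (coord y k)).
Proof.
intros hx; eapply Rle_trans; [apply (norm_single _ k) |].
- intros m hm.
  change (minus (coord x m) (restrict (eq k) (coord y) m) = zero).
  rewrite hx, restrict_out by congruence; apply (minus_eq_zero (G := X m)).
- change (norm (minus (coord x k) (restrict (eq k) (coord y) k))
    <= norm (minus (coord x k) (coord y k))).
  rewrite restrict_in by reflexivity; apply Rle_refl.
Qed.

(* Vectors with finitely many nonzero coordinates, each taken in a countable
   dense set, are enumerated by iterating the Cantor pairing. *)
Lemma regular_separable : (forall k, separable (X k)) -> separable E.
Proof.
intros hX.
assert (hg : forall n, exists g : nat -> E, forall x eps, 0 < eps ->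
  exists i, norm (minus (g i) (cut (fun k => irank k = n) x)) < eps).
{ intros n; destruct (classic (exists k : J, irank k = n)) as [[k hk] | h].
  - destruct (hX k) as [u hu].
    destruct (functional_choice _ (fun i => exists_elt_single k (u i))) as [g hg].
    exists g; intros x eps he.
    destruct (cut_rank x n) as [(k' & hk' & ->) | [h _]]; [| now elim (h k)].
    assert (k' = k) by (apply irank_inj; congruence); subst k'.
    destruct (proj1 (dense_adherent _) hu (coord x k) eps he) as (a & [i ->] & ha).
    exists i; eapply Rle_lt_trans; [apply minus_singles, hg |].
    destruct (hg i) as [-> _]; exact ha.
  - exists (fun _ => zero); intros x eps he; exists O.
    destruct (cut_rank x n) as [(k & hk & _) | [_ ->]]; [elim h; now exists k |].
    now rewrite norm_minus_self. }
destruct (functional_choice _ hg) as [g hg'].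
set (f := fix f n c := match n with
  | O => zero
  | S m => plus (f m (fst (of_nat c))) (g m (snd (of_nat c))) end).
exists (fun c => f (fst (of_nat c)) (snd (of_nat c))).
apply dense_adherent; intros x eps he.
destruct (cut_below_approx x (eps / 2)) as [n hn]; [lra |].
assert (h : forall n d, 0 < d ->
  exists c, norm (minus (f n c) (cut (below n) x)) < d).
{ clear n hn; induction n as [| n IH]; intros d hd.
  - exists O; rewrite cut_below_0; simpl; now rewrite norm_minus_self.
  - destruct (IH (d / 2)) as [c hc]; [lra |].
    destruct (hg' n x (d / 2)) as [i hi]; [lra |].
    exists (to_nat (c, i)); rewrite cut_below_S.
    change (f (S n) (to_nat (c, i))) with (plus
      (f n (fst (of_nat (to_nat (c, i))))) (g n (snd (of_nat (to_nat (c, i)))))).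
    rewrite cancel_of_to; cbn [fst snd].
    eapply Rle_lt_trans; [apply norm_minus_plus |]; lra. }
destruct (h n (eps / 2)) as [c hc]; [lra |].
exists (f n c); split.
- exists (to_nat (n, c)); now rewrite cancel_of_to.
- eapply Rle_lt_trans; [apply (norm_minus_trans _ (cut (below n) x)) |]; lra.
Qed.

(** The limit [y] is taken coordinatewise. The truncations of [y - x m] are small uniformly in the
    cut-off rank, so [reg_limit] puts [y] in [E] and convergence holds in norm. *)
Lemma regular_complete : seq_complete (Y := E).
Proof.
intros x hx.
assert (hlim : forall k, exists y : X k, forall eps : posreal,
  eventually (fun n => ball y eps (coord (x n) k))).
{ intros k.
  destruct (proj1 (filterlim_locally_cauchy (U := X k) (F := eventually)
    (fun n => coord (x n) k))) as [y hy].
  - intros eps; destruct (hx eps) as [N hN].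
    exists (fun n => (N <= n)%nat); split; [now exists N |].
    intros u v hu hv; apply (norm_compat1 (V := X k)).
    eapply Rle_lt_trans; [apply (norm_coord (minus (x v) (x u)) k) |].
    exact (hN u v hu hv).
  - exists y; intros eps; apply (hy (fun t => ball y eps t)).
    now exists eps. }
set (y := fun k => proj1_sig (constructive_indefinite_description _ (hlim k))).
assert (hy : forall k eps, 0 < eps ->
  eventually (fun n => norm (minus (y k) (coord (x n) k)) < eps)).
{ intros k eps he; unfold y.
  destruct (constructive_indefinite_description _ (hlim k)) as [t ht]; simpl.
  destruct (ball_norm_locally (V := X k) t
    (fun s => norm (minus s t) < eps) eps he (fun s h => h)) as [d hd].
  destruct (ht d) as [N hN]; exists N; intros n hn.
  rewrite (norm_minus_sym (V := X k)); apply hd; now apply hN. }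
set (D := fun n m => restrict (below n) (pplus X y (popp X (coord (x m))))).
assert (hfin : forall n z, mem E (restrict (below n) z)).
{ intros n z; apply (mem_restrict_rank E).
  intros s k hs; now apply (reg_single E hE s k). }
(* For fixed [n] only finitely many coordinates are involved, so coordinatewise convergence is
   enough. *)
assert (hD : forall n eps, 0 < eps -> eventually (fun m => snorm E (D n m) < eps)).
{ intros n; induction n as [| n IH]; intros eps he.
  - exists O; intros m _; unfold D, below; rewrite restrict_rank_0.
    eapply Rle_lt_trans; [apply snorm_zero | exact he].
  - destruct (IH (eps / 2)) as [N hN]; [lra |].
    assert (hr : eventually (fun m => snorm E (restrict (fun k => irank k = n)
      (pplus X y (popp X (coord (x m))))) < eps / 2)).
    { destruct (classic (exists k : J, irank k = n)) as [[k hk] | h].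
      - destruct (hy k (eps / 2)) as [M hM]; [lra |].
        exists M; intros m hm; specialize (hM m hm).
        eapply Rle_lt_trans; [apply (reg_single E hE _ k) |].
        + intros i hi; apply restrict_out; intros e; apply hi, irank_inj; congruence.
        + rewrite restrict_in by assumption; exact hM.
      - exists O; intros m _.
        replace (restrict _ _) with (pzero X).
        + eapply Rle_lt_trans; [apply snorm_zero | lra].
        + apply functional_extensionality_dep; intros k; symmetry.
          apply restrict_out; intros e; apply h; now exists k. }
    destruct hr as [M hM]; exists (Nat.max N M); intros m hm.
    unfold D, below; rewrite restrict_rank_S.
    eapply Rle_lt_trans; [apply snorm_triangle |].
    + apply (hfin n).
    + apply (mem_restrict_rank_eq E); intros s k hs; now apply (reg_single E hE s k).
    + generalize (hN m ltac:(lia)) (hM m ltac:(lia)); unfold D, below; lra. }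
(* Uniformity in [n]: the truncation of [y - x m] splits through [x q] with [q] large depending on
   [n]. The part [x q - x m] is controlled by the Cauchy property, the part [y - x q] is arbitrarily
   small. *)
assert (hu : forall eps : posreal, exists N, forall m, (N <= m)%nat ->
  forall n, snorm E (D n m) <= eps).
{ intros eps; destruct (hx eps) as [N hN]; exists N; intros m hm n.
  apply le_epsilon; intros d hd; destruct (hD n d hd) as [M hM].
  specialize (hM (Nat.max N M) ltac:(lia)).
  specialize (hN m (Nat.max N M) hm ltac:(lia)).
  set (q := Nat.max N M) in *.
  replace (D n m) with (pplus X (coord (cut (below n) (minus (x q) (x m)))) (D n q)).
  - eapply Rle_trans; [apply snorm_triangle; [apply coord_mem | apply hfin] |].
    apply Rplus_le_compat; [| lra].
    eapply Rle_trans; [apply (norm_cut_le (below n) (minus (x q) (x m))) |].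
    exact (Rlt_le _ _ hN).
  - unfold D; rewrite coord_cut, <- restrict_plus; f_equal.
    apply functional_extensionality_dep; intros k.
    change (plus (minus (coord (x q) k) (coord (x m) k))
      (minus (y k) (coord (x q) k)) = minus (y k) (coord (x m) k)).
    rewrite (plus_comm (G := X k)); symmetry.
    apply (minus_trans (G := X k)). }
assert (hmem : mem E y).
{ apply (reg_limit E hE); intros eps he.
  destruct (hu (mkposreal eps he)) as [N hN].
  exists (coord (x N)); split; [apply coord_mem |].
  intros n; exact (hN N (Nat.le_refl N) n). }
exists (exist _ y hmem : E); intros eps.
destruct (hu (pos_div_2 (pos_div_2 eps))) as [N hN]; simpl in hN.
exists N; intros m hm.
set (e := minus (exist _ y hmem : E) (x m)).
assert (he : norm e < eps); [| exact he].
destruct (cut_below_approx e (eps / 2)) as [n hn].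
{ generalize (cond_pos eps); lra. }
assert (h1 : norm (cut (below n) e) <= eps / 2 / 2) by exact (hN m hm n).
assert (h2 := norm_minus_trans e (cut (below n) e) zero).
rewrite !(minus_zero_r (G := E)) in h2.
rewrite norm_minus_sym in hn.
eapply Rle_lt_trans; [exact h2 |].
eapply Rlt_le_trans; [apply Rplus_lt_le_compat; [exact hn | exact h1] |].
generalize (cond_pos eps); lra.
Qed.

End RegularSpace.

(** * Iterates of the shift and their action on restrictions *)

Section Dynamics.

Context {K : AbsRing} {J : index} {X : J -> CompleteNormedModule K}.
Context (E : seq_space X) (hE : regular E).
Context (T : forall k : J, X (isucc k) -> X k).
Context (hT : forall k : J, is_linear (T k)).
Context (hM : exists M : R, forall k : J, Rbar_le (op_norm (T k)) (Finite M)).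

Local Notation S := (shift E T hM).
Local Notation coord := (coord E).
Local Notation cut := (cut E hE).

Lemma shift_plus (x y : E) : S (plus x y) = plus (S x) (S y).
Proof.
apply coord_inj; intros k.
exact (linear_plus _ (hT k) (coord x (isucc k)) (coord y (isucc k))).
Qed.

Lemma shift_scal (a : K) (x : E) : S (scal a x) = scal a (S x).
Proof.
apply coord_inj; intros k.
exact (linear_scal _ (hT k) a (coord x (isucc k))).
Qed.

Lemma iter_plus n (x y : E) :
  Nat.iter n S (plus x y) = plus (Nat.iter n S x) (Nat.iter n S y).
Proof.
induction n as [| n IH]; [reflexivity |].
exact (eq_trans (f_equal S IH) (shift_plus _ _)).
Qed.

Lemma iter_scal n (a : K) (x : E) :
  Nat.iter n S (scal a x) = scal a (Nat.iter n S x).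
Proof.
induction n as [| n IH]; [reflexivity |].
exact (eq_trans (f_equal S IH) (shift_scal _ _)).
Qed.

Lemma iter_zero n : Nat.iter n S zero = zero.
Proof.
induction n as [| n IH]; [reflexivity |].
refine (eq_trans (f_equal S IH) _); apply coord_inj; intros k.
exact (linear_zero _ (hT k)).
Qed.

Lemma iter_fixed (z : E) : S z = z -> forall n, Nat.iter n S z = z.
Proof.
intros h n; induction n as [| n IH]; [reflexivity |].
exact (eq_trans (f_equal S IH) h).
Qed.

Lemma shift_preimage_open (V : E -> Prop) : open V -> open (fun y => V (S y)).
Proof.
intros hV x hx; destruct (reg_shift E hE T hM) as (C & hC & hS).
destruct (hV _ hx) as [d hd].
assert (hd' := cond_pos d).
(* [C + 1] instead of [C] avoids a division by zero. *)
apply (ball_norm_locally x _ (d / (C + 1))).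
{ apply Rdiv_lt_0_compat; lra. }
intros y hy; apply hd, norm_compat1.
replace (minus (S y) (S x)) with (S (minus y x)).
- eapply Rle_lt_trans; [exact (hS _ (coord_mem E (minus y x))) |].
  change (C * norm (minus y x) < d).
  apply Rmult_lt_compat_l with (r := C + 1) in hy; [| lra].
  replace ((C + 1) * (d / (C + 1))) with (pos d) in hy by (field; lra).
  generalize (norm_ge_0 (minus y x)); lra.
- apply (plus_reg_r (G := E) (S x)).
  rewrite <- shift_plus; unfold minus.
  rewrite <- !(plus_assoc (G := E)), !(plus_opp_l (G := E)).
  now rewrite !(plus_zero_r (G := E)).
Qed.

Lemma cut_ext (P Q : J -> Prop) x : (forall k, P k <-> Q k) -> cut P x = cut Q x.
Proof.
intros h; apply coord_inj; intros k; rewrite !coord_cut.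
apply (f_equal (fun s => s k)), restrict_ext, h.
Qed.

Lemma minus_cut_cut (P Q R : J -> Prop) x :
  (forall k, P k <-> Q k \/ R k) -> (forall k, Q k -> ~ R k) ->
  minus (cut P x) (cut Q x) = cut R x.
Proof.
intros h d.
assert (e : cut P x = plus (cut Q x) (cut R x)).
{ apply coord_inj; intros k.
  exact (f_equal (fun s => s k) (restrict_disjoint_union Q R P (coord x) h d)). }
rewrite e; unfold minus.
rewrite (plus_comm (G := E)), (plus_assoc (G := E)), (plus_opp_l (G := E)).
apply (plus_zero_l (G := E)).
Qed.

(** Coordinate [k] of the shift reads coordinate [isucc k], so the cutting set moves back by one;
    linearity of [T k] sends the removed coordinates to zero. *)
Lemma shift_cut (P : J -> Prop) x : S (cut P x) = cut (fun k => P (isucc k)) (S x).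
Proof.
apply coord_inj; intros k.
change (T k (restrict P (coord x) (isucc k)) =
  restrict (fun k => P (isucc k)) (coord (S x)) k).
destruct (classic (P (isucc k))) as [h | h].
- now rewrite !restrict_in.
- rewrite !restrict_out by assumption; exact (linear_zero _ (hT k)).
Qed.

Lemma iter_cut n (P : J -> Prop) x :
  Nat.iter n S (cut P x) = cut (fun k => P (Nat.iter n isucc k)) (Nat.iter n S x).
Proof.
induction n as [| n IH]; [reflexivity |].
refine (eq_trans (f_equal S IH) (eq_trans (shift_cut _ _) _)).
apply cut_ext; intros k.
now rewrite <- Nat.iter_succ_r.
Qed.

(** * Residue classes: from periodic points to fixed points *)

(** For [d = 0] this is equality of positions, consistent with the zeroth iterate being the
    identity. *)
Definition congruent (d : nat) (k m : J) : Prop :=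
  (Z.of_nat d | ipos m - ipos k)%Z.

Lemma congruent_iter d k m : congruent d k (Nat.iter d isucc m) <-> congruent d k m.
Proof.
unfold congruent; rewrite ipos_iter; split; intros [q hq];
  [exists (q - 1)%Z | exists (q + 1)%Z]; lia.
Qed.

Lemma iter_cut_congruent d k x :
  Nat.iter d S x = x -> Nat.iter d S (cut (congruent d k) x) = cut (congruent d k) x.
Proof.
intros h; rewrite iter_cut, h; apply cut_ext; intros m; apply congruent_iter.
Qed.

Lemma congruent_far d k m : congruent d k m -> m <> k ->
  (Z.of_nat d <= Z.abs (ipos m - ipos k))%Z.
Proof.
intros h hm; apply Z.divide_pos_le.
- assert (ipos m <> ipos k) by (intros e; now apply hm, ipos_inj); lia.
- now apply Z.divide_abs_r.
Qed.

(* Summing a [d]-periodic vector supported in a single residue class over its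
   orbit yields a fixed point with the same coordinate in the class. *)
Lemma fixed_of_periodic (y : E) k : periodic S y ->
  exists z : E, S z = z /\ coord z k = coord y k.
Proof.
intros (d & hd & hy); set (w := cut (congruent d k) y).
assert (hw : Nat.iter d S w = w) by now apply iter_cut_congruent.
set (s := fix s n := match n with
  | O => zero : E | Datatypes.S n => plus (s n) (Nat.iter n S w) end).
(* Here [s n] is [w + S w + ... + S^(n-1) w]. At [n = d] the last term is [w] again, and cancelling
   it makes [s d] a fixed point. *)
assert (telescope : forall n, plus (S (s n)) w = plus (s n) (Nat.iter n S w)).
{ induction n as [| n IH].
  - exact (f_equal (fun t => plus t w) (iter_zero 1)).
  - change (plus (S (plus (s n) (Nat.iter n S w))) w =
      plus (plus (s n) (Nat.iter n S w)) (S (Nat.iter n S w))).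
    rewrite shift_plus, <- IH, <- !(plus_assoc (G := E)); f_equal.
    apply (plus_comm (G := E)). }
(* Only the first summand contributes at [k]: coordinate [k] of [S^i w] reads position [k + i],
   which leaves the residue class when [0 < i < d]. *)
assert (hcoord : forall n, (n < d)%nat ->
  coord (s (Datatypes.S n)) k = coord y k).
{ intros n; induction n as [| n IH]; intros hn.
  - change (plus (zero : X k) (restrict (congruent d k) (coord y) k) = coord y k).
    rewrite (plus_zero_l (G := X k)); apply restrict_in.
    exists 0%Z; lia.
  - change (plus (coord (s (Datatypes.S n)) k)
      (coord (Nat.iter (Datatypes.S n) S w) k) = coord y k).
    rewrite IH by lia; unfold w; rewrite iter_cut, coord_cut, restrict_out.
    + apply (plus_zero_r (G := X k)).
    + intros h; apply congruent_far in h.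
      * rewrite ipos_iter in h; lia.
      * intros e; apply (f_equal ipos) in e; rewrite ipos_iter in e; lia. }
exists (s d); split.
- apply (plus_reg_r (G := E) w); rewrite telescope, hw; reflexivity.
- destruct d as [| d]; [lia | apply hcoord; lia].
Qed.

(** * Fixed points and orbits through a coordinate *)

(** Intermediate condition between the orbit condition and the dynamics; it has the same form over
    both index sets. *)
Definition fixed_span_dense : Prop :=
  forall k, exists D : X k -> Prop, dense (span D) /\
    forall x, D x -> exists z : E, S z = z /\ coord z k = x.

(** Evaluation at [k] is onto and does not increase norms, so the [k]-th coordinates of periodic
    points are dense in [X k]; each is also a coordinate of a fixed point. *)
Lemma fixed_span_of_periodic : dense (periodic S) -> fixed_span_dense.
Proof.
intros hd k; exists (fun x => exists z : E, S z = z /\ coord z k = x).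
split; [| now intros].
apply (dense_adherent (V := X k)); intros a eps he.
destruct (exists_elt_single E hE k a) as (x & <- & _).
destruct (proj1 (dense_adherent _) hd x eps he) as (y & hy & hyx).
exists (coord y k); split.
- now apply span_in, fixed_of_periodic.
- eapply Rle_lt_trans; [exact (norm_coord E hE (minus y x) k) | exact hyx].
Qed.

Lemma Tcomp_iter j m (z : pseq X) :
  Nat.iter j (pshift T) z m = Tcomp T j m (z (Nat.iter j isucc m)).
Proof.
revert z; induction j as [| j IH]; intros z; [reflexivity |].
rewrite Nat.iter_succ_r, IH; reflexivity.
Qed.

Lemma coord_iter n (x : E) : coord (Nat.iter n S x) = Nat.iter n (pshift T) (coord x).
Proof.
induction n as [| n IH]; [reflexivity |].
simpl; rewrite <- IH; reflexivity.
Qed.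

Lemma orbits_of_fixed : fixed_span_dense -> dense_span_of_orbits T E.
Proof.
intros h k; destruct (h k) as (D & hD & hz); exists D; split; [exact hD |].
intros x hx; destruct (hz x hx) as (z & hfix & <-).
(* Over the integers nothing is removed; over the positive integers the coordinates before [k]
   become the zeros required of the orbit. *)
set (P := fun m : J => J = Integers \/ ile k m).
exists (restrict P (coord z)); split; [| apply (mem_restrict E hE), coord_mem].
assert (hc : forall n, T n (coord z (isucc n)) = coord z n).
{ intros n; exact (f_equal (fun y => coord y n) hfix). }
unfold P; repeat split.
- apply restrict_in; right; apply ile_ipos; lia.
- intros n hn; apply ile_ipos in hn.
  rewrite !restrict_in; [apply hc | right; apply ile_ipos; lia | right].
  apply ile_ipos; rewrite ipos_isucc; lia.
- intros hJ n hn; apply restrict_out; intros [e | e]; [congruence |].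
  apply ile_ipos in e; apply ilt_ipos in hn; lia.
- intros hJ m j e; rewrite !restrict_in by now left.
  now rewrite <- Tcomp_iter, <- coord_iter, (iter_fixed z hfix).
Qed.

(* On the positive integers the initial zeros of the orbit are replaced by the
   images of [x]. *)
Lemma fixed_of_orbit k x z : orbit_through T k x z -> mem E z ->
  exists z' : E, S z' = z' /\ coord z' k = x.
Proof.
intros (hk & hr & _ & hl) hz.
(* For [m] before [k] this is the image of [x] in [X m] under the composed operators; from [k] on,
   [Z.to_nat] truncates the exponent to 0 and [y] agrees with [z]. *)
set (y := fun m => Nat.iter (Z.to_nat (ipos k - ipos m)) (pshift T) z m).
assert (hyr : forall m, (ipos k <= ipos m)%Z -> y m = z m).
{ intros m hm; unfold y.
  now replace (Z.to_nat (ipos k - ipos m)) with O by lia. }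
assert (hy : mem E y).
{ assert (hJ : J = Naturals \/ J = Integers) by (clear; destruct J; auto).
  destruct hJ as [hJ | hJ].
  (* Over the positive integers every position before [k] has rank below this [n], so [y] differs
     from [z] in finitely many coordinates only. *)
  - set (n := Z.to_nat (2 * ipos k)).
    replace y with (pplus X (restrict (fun m => (irank m < n)%nat) y)
      (restrict (fun m => ~ (irank m < n)%nat) z)).
    + apply mem_plus; [| now apply (mem_restrict E hE)].
      apply (mem_restrict_rank E); intros s i hs; now apply (reg_single E hE s i).
    + apply functional_extensionality_dep; intros m; unfold pplus.
      destruct (classic (irank m < n)%nat) as [h | h].
      * rewrite (restrict_in _ y), (restrict_out _ z) by tauto.
        apply (plus_zero_r (G := X m)).
      * rewrite (restrict_out _ y), (restrict_in _ z) by tauto.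
        rewrite (plus_zero_l (G := X m)); symmetry; apply hyr.
        assert (hp : (0 <= ipos m)%Z).
        { revert hJ; clear; unfold ipos; intros hJ; destruct J; [simpl; lia | easy]. }
        generalize (irank_le m); lia.
  - replace y with z; [exact hz |].
    apply functional_extensionality_dep; intros m.
    destruct (Z.le_gt_cases (ipos k) (ipos m)) as [h | h]; [symmetry; now apply hyr |].
    unfold y; rewrite Tcomp_iter; apply hl; [exact hJ |].
    apply ipos_inj; rewrite ipos_iter; lia. }
exists (exist _ y hy : E); split.
- apply coord_inj; intros m; change (T m (y (isucc m)) = y m).
  destruct (Z.le_gt_cases (ipos k) (ipos m)) as [h | h].
  + rewrite !hyr by (rewrite ?ipos_isucc; lia).
    apply hr, ile_ipos; exact h.
  + unfold y; rewrite ipos_isucc.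
    replace (Z.to_nat (ipos k - ipos m)) with
      (Datatypes.S (Z.to_nat (ipos k - (ipos m + 1)))) by lia.
    reflexivity.
- change (y k = x); rewrite hyr by lia; exact hk.
Qed.

Lemma fixed_of_orbits : dense_span_of_orbits T E -> fixed_span_dense.
Proof.
intros h k; destruct (h k) as (D & hD & hz); exists D; split; [exact hD |].
intros x hx; destruct (hz x hx) as (z & ho & hm); now apply (fixed_of_orbit k x z).
Qed.

(* The sequences of Kitai's criterion, together with the points [w n] of period
   [n]. *)
Definition kitai (v : E) : Prop :=
  exists r w : nat -> E,
    tends_zero (fun n => Nat.iter n S v) /\ tends_zero r /\
    tends_zero (fun n => minus (w n) v) /\
    forall n, Nat.iter n S (r n) = v /\ Nat.iter n S (w n) = w n.

(** * The vectors of Kitai's criterion and their density *)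

Lemma kitai_zero : kitai zero.
Proof.
exists (fun _ => zero), (fun _ => zero).
split; [| split; [apply tends_zero_cst | split]].
- apply (tends_zero_ext (fun _ => zero)); [| apply tends_zero_cst].
  intros n; symmetry; apply iter_zero.
- apply (tends_zero_ext (fun _ => zero)); [| apply tends_zero_cst].
  intros n; symmetry; apply (minus_zero_r (G := E)).
- intros n; split; apply iter_zero.
Qed.

Lemma kitai_plus u v : kitai u -> kitai v -> kitai (plus u v).
Proof.
intros (r & w & h1 & h2 & h3 & h4) (r' & w' & h1' & h2' & h3' & h4').
exists (fun n => plus (r n) (r' n)), (fun n => plus (w n) (w' n)).
split; [| split; [now apply tends_zero_plus | split]].
- eapply tends_zero_ext; [| exact (tends_zero_plus _ _ h1 h1')].
  intros n; symmetry; apply iter_plus.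
- eapply tends_zero_ext; [| exact (tends_zero_plus _ _ h3 h3')].
  intros n; symmetry; apply (minus_plus_plus (G := E)).
- intros n; destruct (h4 n) as [e1 e2], (h4' n) as [e1' e2'].
  rewrite !iter_plus; split; congruence.
Qed.

Lemma kitai_scal a v : kitai v -> kitai (scal a v).
Proof.
intros (r & w & h1 & h2 & h3 & h4).
exists (fun n => scal a (r n)), (fun n => scal a (w n)).
split; [| split; [now apply tends_zero_scal | split]].
- eapply tends_zero_ext; [| exact (tends_zero_scal a _ h1)].
  intros n; symmetry; apply iter_scal.
- eapply tends_zero_ext; [| exact (tends_zero_scal a _ h3)].
  intros n; apply (scal_minus_distr_l (V := E)).
- intros n; destruct (h4 n) as [e1 e2].
  rewrite !iter_scal; split; congruence.
Qed.

Lemma kitai_fixed (z : E) k : S z = z -> kitai (cut (eq k) z).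
Proof.
intros hz.
exists (fun n => cut (eq (Nat.iter n isucc k)) z), (fun n => cut (congruent n k) z).
split; [| split; [| split]].
(* The cutting set is the position [k - n]; over the positive integers it is empty for large [n]. *)
- apply (tends_zero_ext (fun n => cut (fun m => k = Nat.iter n isucc m) z)).
  { intros n; now rewrite iter_cut, iter_fixed. }
  apply tends_zero_cut; intros b; exists (Z.to_nat (b + ipos k)).
  intros n hn m hm; apply (f_equal ipos) in hm; rewrite ipos_iter in hm; lia.
- apply tends_zero_cut; intros b; exists (Z.to_nat (b - ipos k)).
  intros n hn m <-; rewrite ipos_iter; lia.
(* Removing [k] from its class modulo [n] leaves positions at distance at least [n] from [k]. *)
- apply (tends_zero_ext (fun n => cut (fun m => congruent n k m /\ m <> k) z)).
  { intros n; symmetry; apply minus_cut_cut; intros m; [| intros ->; tauto].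
    split; [destruct (classic (m = k)); auto |].
    intros [<- | h]; [exists 0%Z; lia | tauto]. }
  apply tends_zero_cut; intros b; exists (Z.to_nat (b + Z.abs (ipos k))).
  intros n hn m [h h']; apply congruent_far in h; [lia | exact h'].
- intros n; split.
  + rewrite iter_cut, iter_fixed by exact hz; apply cut_ext; intros m.
    split; [| now intros ->]; intros e; apply (f_equal ipos) in e.
    rewrite !ipos_iter in e; apply ipos_inj; lia.
  + now apply iter_cut_congruent, iter_fixed.
Qed.

(** The predicate [kitai] is stable under linear combinations, so every element of [span D], placed
    at coordinate [k], satisfies it; such vectors approximate every vector supported at [k]. *)
Lemma kitai_dense : fixed_span_dense -> dense kitai.
Proof.
intros h; apply (dense_of_singles E hE); [apply kitai_zero | apply kitai_plus |].
intros k x eps he; destruct (h k) as (D & hD & hz).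
assert (hspan : forall a, span D a -> exists v : E, kitai v /\
  coord v k = a /\ forall m, m <> k -> coord v m = zero).
{ intros a ha; induction ha as [| a ha | a b _ IHa _ IHb | c a _ IHa].
  - exists zero; split; [apply kitai_zero |]; split; reflexivity.
  - destruct (hz a ha) as (z & hfix & hzk); exists (cut (eq k) z).
    split; [now apply kitai_fixed |]; split.
    + rewrite coord_cut, restrict_in; auto.
    + intros m hm; apply restrict_out; congruence.
  - destruct IHa as (u & hu & <- & hu'), IHb as (v & hv & <- & hv').
    exists (plus u v); split; [now apply kitai_plus |]; split; [reflexivity |].
    intros m hm; change (plus (coord u m) (coord v m) = zero).
    rewrite hu', hv' by exact hm; apply (plus_zero_l (G := X m)).
  - destruct IHa as (u & hu & <- & hu').
    exists (scal c u); split; [now apply kitai_scal |]; split; [reflexivity |].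
    intros m hm; change (scal c (coord u m) = zero).
    rewrite hu' by exact hm; apply (scal_zero_r (V := X m)). }
destruct (proj1 (dense_adherent (V := X k) _) hD (coord x k) eps he)
  as (a & ha & hax).
destruct (hspan a ha) as (v & hv & <- & hv').
exists v; split; [exact hv |].
eapply Rle_lt_trans; [now apply (minus_singles E hE k) | exact hax].
Qed.

(** * Mixing, periodic points and chaos *)

(** With [u] in [U] and [v] in [V], the vector [u + r n] tends to [u], while its image under [S^n]
    is [S^n u + v] and tends to [v]. *)
Lemma mixing_of_kitai : dense kitai -> mixing S.
Proof.
intros hd U V hU hV hU0 hV0.
destruct (hd U hU hU0) as (u & hu & _ & _ & hf & _).
destruct (hd V hV hV0) as (v & hv & r & w & _ & hr & _ & hrv).
destruct (hU u hu) as [e he], (hV v hv) as [e' he'].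
destruct (hr e (cond_pos e)) as [N hN], (hf e' (cond_pos e')) as [N' hN'].
exists (Nat.max N N'); intros n hn; exists (plus u (r n)).
assert (hpm : forall a b : E, minus (plus a b) a = b).
{ intros a b; unfold minus.
  rewrite (plus_comm (G := E) a b), <- (plus_assoc (G := E)).
  rewrite (plus_opp_r (G := E)); apply (plus_zero_r (G := E)). }
split.
- apply he, norm_compat1; rewrite hpm; apply hN; lia.
- apply he', norm_compat1; rewrite iter_plus, (proj1 (hrv n)).
  rewrite (plus_comm (G := E)), hpm; apply hN'; lia.
Qed.

Lemma periodic_dense_of_kitai : dense kitai -> dense (periodic S).
Proof.
intros hd; apply dense_adherent; intros x; apply adherent_trans; intros eps he.
destruct (proj1 (dense_adherent _) hd x eps he) as (v & hv & hvx).
exists v; split; [| exact hvx].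
destruct hv as (r & w & _ & _ & hw & hper).
intros d hd'; destruct (hw d hd') as [N hN].
(* The index is raised by one because a period must be at least 1. *)
exists (w (Datatypes.S N)); split; [| apply hN; lia].
exists (Datatypes.S N); split; [lia | apply hper].
Qed.

Lemma chaotic_of_kitai :
  (forall k, separable (X k)) -> dense kitai -> chaotic S.
Proof.
intros hX hd; split; [| now apply periodic_dense_of_kitai].
apply transitive_hypercyclic.
- now apply regular_complete.
- now apply regular_separable.
- apply shift_preimage_open.
- intros U V hU hV hU0 hV0.
  destruct (mixing_of_kitai hd U V hU hV hU0 hV0) as [N hN].
  exists N; now apply hN.
Qed.

End Dynamics.

Theorem proposition3p5
    (K : AbsRing) (hK : K = R_AbsRing \/ K = C_AbsRing)
    (J : index) (X : J -> CompleteNormedModule K)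
    (T : forall k : J, X (isucc k) -> X k)
    (hT : forall k : J, is_linear (T k))
    (hM : exists M : R, forall k : J, Rbar_le (op_norm (T k)) (Finite M))
    (p : R) (hp : 1 <= p)
    (E : seq_space X) (hE : E = lp X p hp \/ E = c0 X) :
  (chaotic (shift E T hM) -> dense_span_of_orbits T E) /\
  ((forall k : J, separable (X k)) ->
     dense_span_of_orbits T E -> chaotic (shift E T hM)) /\
  (chaotic (shift E T hM) -> mixing (shift E T hM)).
Proof.
assert (hreg : regular E).
{ destruct hE as [-> | ->]; [apply lp_regular | apply c0_regular]. }
clear hE; repeat split.
- intros [_ h]; apply (orbits_of_fixed E hreg T hM).
  now apply fixed_span_of_periodic.
(* Chaos has been split into hypercyclicity and density of the periodic points: this goal and the
   next. *)
- apply (chaotic_of_kitai E hreg T hT hM); [assumption |].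
  now apply (kitai_dense E hreg T hT hM), fixed_of_orbits.
- now apply (chaotic_of_kitai E hreg T hT hM), (kitai_dense E hreg T hT hM),
    fixed_of_orbits.
- intros [_ h]; apply (mixing_of_kitai E T hT hM).
  now apply (kitai_dense E hreg T hT hM), fixed_span_of_periodic.
Qed.
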